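(* Let $f$ be a holomorphic function on the open unit disk $\mathbb{D}$. Suppose that, for some integer $n\ge 1$, we have $f(0)=f'(0)=\cdots=f^{(n-1)}(0)=0$ and $f^{(n)}(0)>0$ (in particular $f^{(n)}(0)$ is real). Suppose further that $$|f(z)|\le \bigl|f(|z|)\bigr| \quad\text{for all } z\in\mathbb{D}.$$ Then the restriction $f|_{[0,1)}$ is real-valued, positive on $(0,1)$, strictly increasing on $[0,1)$, and convex on $[0,1)$. Moreover, $f$ is strictly convex on $[0,1)$ unless there is $\alpha>0$ such that $f(z)=\alpha z$ for all $z\in\mathbb{D}$.
   Context: $\mathbb{D}=\{z\in\mathbb{C}:|z|<1\}$, and $[0,1)$ is regarded as a subset of $\mathbb{D}$. *)

(* Defs.v *)
From Stdlib Require Import Reals.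
From Coquelicot Require Export Coquelicot.
Open Scope R_scope.

Definition unit_disk (z : C) : Prop := Cmod z < 1.

(* A function holomorphic on [U] is represented by a total function on [C];
   its values outside [U] are irrelevant.  Over the complex absolute ring,
   [ex_derive] is complex differentiability. *)
Definition holomorphic_on (U : C -> Prop) (f : C -> C) : Prop :=
  forall z : C, U z -> @ex_derive C_AbsRing C_NormedModule f z.

(* The complex analogue of Coquelicot's [Derive_n].  [C_derive] is total; it
   agrees with the complex derivative wherever the latter exists
   ([is_C_derive_unique]). *)
Fixpoint C_derive_n (f : C -> C) (n : nat) (z : C) : C :=
  match n with
  | O => f z
  | S m => C_derive (C_derive_n f m) z
  end.

Definition strictly_increasing_on (D : R -> Prop) (g : R -> R) : Prop :=
  forall x y : R, D x -> D y -> x < y -> g x < g y.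

(* Used only on intervals, so that the convex combinations stay in [D]. *)
Definition convex_on (D : R -> Prop) (g : R -> R) : Prop :=
  forall x y t : R, D x -> D y -> 0 <= t <= 1 ->
    g (t * x + (1 - t) * y) <= t * g x + (1 - t) * g y.

Definition strictly_convex_on (D : R -> Prop) (g : R -> R) : Prop :=
  forall x y t : R, D x -> D y -> x <> y -> 0 < t < 1 ->
    g (t * x + (1 - t) * y) < t * g x + (1 - t) * g y.

(* Main.v *)
Require Import Defs.
From Stdlib Require Import Reals Lra Lia Classical ClassicalEpsilon Wf_nat.
From Coquelicot Require Import Coquelicot.
Open Scope R_scope.

(* On each circle |z| = x the modulus of f is maximal at the point x. In polar
   coordinates the first-order condition at that point says that x f'(x) / f(x)
   is real, so the argument of f is constant along (0,1); since f(x) ~ a x^n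
   with a > 0, f is positive there. The second-order condition says that
   h(x) = x f'(x) / f(x) is nondecreasing, and f(x) ~ a x^n forces h >= n >= 1.
   Hence f' > 0 and x^2 f'' >= f h (h - 1) >= 0, where equality at one point
   forces h = 1 to the left of it, hence f(z) = alpha z.

   The smoothness needed comes from Cauchy's theorem. Goursat's theorem is applied to
   q(e^s) e^s on rectangles of height 2 pi, so that the integral of q(z) z over
   the circle of radius r does not depend on r; the exceptional point of a difference
   quotient q costs nothing, since that integral is continuous in r. *)

(** * Differentiation and integration along paths *)

(** Holomorphy provides only one derivative, with no continuity of it, while the second-order
    condition needs a second derivative along the axis and a cubic error bound off it. Both are read
    off one Taylor expansion with geometric remainder. Dividing by f requires that f has no zero on
    (0,1). If f(x) = 0, maximality makes f vanish on the whole circle |z| = x; the Taylor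
    coefficients at 0, being integrals over that circle, then vanish too, against the leading term a
    x^n. The order of the two conditions matters: the second one is tested with real Taylor
    coefficients, and these are available only after the first one has made f real along the axis.
    In both tests the circle is run through by x (1 + it) / (1 - it) rather than x e^(it), so that
    no trigonometric expansion is needed: clearing denominators leaves polynomials in t, and a sign
    is obtained by letting t tend to 0. *)

Definition cderiv (f : C -> C) (z l : C) : Prop :=
  forall eps : R, 0 < eps -> exists delta : R, 0 < delta /\
    forall w : C, Cmod (w - z) < delta ->
      Cmod (f w - f z - l * (w - z)) <= eps * Cmod (w - z).

Definition ccont (f : C -> C) (z : C) : Prop :=
  forall eps : R, 0 < eps -> exists delta : R, 0 < delta /\
    forall w : C, Cmod (w - z) < delta -> Cmod (f w - f z) < eps.

Definition pcont (p : R -> C) (t : R) : Prop :=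
  forall eps : R, 0 < eps -> exists delta : R, 0 < delta /\
    forall s : R, Rabs (s - t) < delta -> Cmod (p s - p t) < eps.

Lemma Re_le_Cmod (z : C) : Rabs (Re z) <= Cmod z.
Proof.
apply Rle_trans with (2 := Rmax_Cmod z). apply Rmax_l.
Qed.

Lemma Im_le_Cmod (z : C) : Rabs (Im z) <= Cmod z.
Proof.
apply Rle_trans with (2 := Rmax_Cmod z). apply Rmax_r.
Qed.

Lemma Cmod_le_Re_Im (z : C) : Cmod z <= Rabs (Re z) + Rabs (Im z).
Proof.
destruct z as [x y]; unfold Cmod; simpl.
rewrite <- (sqrt_Rsqr (Rabs x + Rabs y)).
2: { generalize (Rabs_pos x) (Rabs_pos y); lra. }
apply sqrt_le_1_alt. unfold Rsqr.
generalize (Rabs_pos x) (Rabs_pos y) (Rsqr_abs x) (Rsqr_abs y); unfold Rsqr; nra.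
Qed.

Lemma Cmod_minus_sym (z w : C) : Cmod (z - w) = Cmod (w - z).
Proof. rewrite <- Cmod_opp. f_equal. ring. Qed.

(** [cderiv] is the difference quotient multiplied out, so w = z needs no exclusion in estimates.
    The equivalence gives access to the library rules for products and compositions. *)
Lemma is_derive_cderiv (f : C -> C) (z l : C) :
  @is_derive C_AbsRing (AbsRing_NormedModule C_AbsRing) f z l <-> cderiv f z l.
Proof.
split.
- intros [_ H] eps He.
  specialize (H z (fun P HP => HP) (mkposreal eps He)).
  destruct H as [d Hd]. exists d; split; [apply cond_pos|].
  intros w Hw. specialize (Hd w Hw).
  change (Cmod (minus (minus (f w) (f z)) (scal (minus w z) l)) <= eps * Cmod (w - z)) in Hd.
  replace (f w - f z - l * (w - z))%C
    with (minus (minus (f w) (f z)) (scal (minus w z) l) : C); [exact Hd|].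
  unfold minus, plus, opp, scal; simpl. unfold mult; simpl. ring.
- intros H. split.
  + apply is_linear_scal_l.
  + intros x Hx.
    apply (@is_filter_lim_locally_unique C_AbsRing (AbsRing_NormedModule C_AbsRing)) in Hx.
    subst x.
    intros eps. destruct (H eps (cond_pos eps)) as [d [Hd H1]].
    exists (mkposreal d Hd). intros w Hw. specialize (H1 w Hw).
    change (Cmod (minus (minus (f w) (f z)) (scal (minus w z) l)) <= eps * Cmod (w - z)).
    replace (minus (minus (f w) (f z)) (scal (minus w z) l) : C)
      with (f w - f z - l * (w - z))%C; [exact H1|].
    unfold minus, plus, opp, scal; simpl. unfold mult; simpl. ring.
Qed.

(** Holomorphy is stated with [C_NormedModule], the differentiation rules with the ring as a module
    over itself. The estimate half of [is_derive] is convertible between the two; only linearity is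
    proved again. *)
Lemma ex_derive_cderiv (f : C -> C) (z : C) :
  @ex_derive C_AbsRing C_NormedModule f z -> exists l, cderiv f z l.
Proof.
intros [l [_ H]]. exists l. apply is_derive_cderiv.
split; [apply is_linear_scal_l|exact H].
Qed.

Lemma cderiv_ccont (f : C -> C) (z l : C) : cderiv f z l -> ccont f z.
Proof.
intros H eps He. destruct (H 1 Rlt_0_1) as [d [Hd H1]].
set (K := 1 + Cmod l).
assert (HK : 0 < K) by (unfold K; generalize (Cmod_ge_0 l); lra).
exists (Rmin d (eps / K)). split.
{ apply Rmin_pos; [lra|]. apply Rdiv_lt_0_compat; lra. }
intros w Hw.
assert (H2 := Rlt_le_trans _ _ _ Hw (Rmin_l _ _)).
assert (H3 := Rlt_le_trans _ _ _ Hw (Rmin_r _ _)).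
specialize (H1 w H2).
replace (f w - f z)%C with ((f w - f z - l * (w - z)) + l * (w - z))%C by ring.
apply Rle_lt_trans with (1 := Cmod_triangle _ _). rewrite Cmod_mult.
apply Rle_lt_trans with (K * Cmod (w - z)); [unfold K; lra|].
apply Rmult_lt_compat_l with (r := K) in H3; [|lra].
replace (K * (eps / K)) with eps in H3 by (field; lra). lra.
Qed.

Lemma pcont_comp (f : C -> C) (p : R -> C) (t : R) :
  ccont f (p t) -> pcont p t -> pcont (fun s => f (p s)) t.
Proof.
intros Hf Hp eps He. destruct (Hf eps He) as [d [Hd H]].
destruct (Hp d Hd) as [d' [Hd' H']]. exists d'; split; auto.
Qed.

Lemma pcont_Re (p : R -> C) (t : R) :
  pcont p t -> continuous (fun s => Re (p s)) t.
Proof.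
intros H. apply continuity_pt_filterlim. intros eps He.
destruct (H eps He) as [d [Hd H1]]. exists d; split; [exact Hd|].
intros x [_ Hx]. apply Rle_lt_trans with (2 := H1 x Hx).
exact (Re_le_Cmod (p x - p t)).
Qed.

Lemma pcont_Im (p : R -> C) (t : R) :
  pcont p t -> continuous (fun s => Im (p s)) t.
Proof.
intros H. apply continuity_pt_filterlim. intros eps He.
destruct (H eps He) as [d [Hd H1]]. exists d; split; [exact Hd|].
intros x [_ Hx]. apply Rle_lt_trans with (2 := H1 x Hx).
exact (Im_le_Cmod (p x - p t)).
Qed.

Lemma continuous_pcont (p : R -> C) (t : R) :
  continuous (fun s => Re (p s)) t -> continuous (fun s => Im (p s)) t ->
  pcont p t.
Proof.
intros H1 H2 eps He.
apply continuity_pt_filterlim in H1. apply continuity_pt_filterlim in H2.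
destruct (H1 (eps / 2)) as [d1 [Hd1 K1]]; [lra|].
destruct (H2 (eps / 2)) as [d2 [Hd2 K2]]; [lra|].
exists (Rmin d1 d2). split; [apply Rmin_pos; lra|].
intros s Hs. apply Rle_lt_trans with (1 := Cmod_le_Re_Im _).
assert (L1 := Rlt_le_trans _ _ _ Hs (Rmin_l _ _)).
assert (L2 := Rlt_le_trans _ _ _ Hs (Rmin_r _ _)).
(* [D_x] excludes the point itself from [continuity_pt], whereas [pcont] includes s = t. *)
destruct (Req_dec s t) as [->|Hst].
{ replace (p t - p t)%C with (RtoC 0) by ring. simpl. rewrite Rabs_R0. lra. }
assert (D : D_x no_cond t s) by (split; [exact I|auto]).
specialize (K1 s (conj D L1)). specialize (K2 s (conj D L2)).
change (Rabs (Re (p s) - Re (p t)) < eps / 2) in K1.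
change (Rabs (Im (p s) - Im (p t)) < eps / 2) in K2.
change (Rabs (Re (p s) - Re (p t)) + Rabs (Im (p s) - Im (p t)) < eps). lra.
Qed.

Definition CInt (p : R -> C) (a b : R) : C :=
  (RInt (fun t => Re (p t)) a b, RInt (fun t => Im (p t)) a b).

Definition pcont_on (a b : R) (p : R -> C) : Prop :=
  forall t, a <= t <= b -> pcont p t.

Lemma pcont_on_ex_RInt (a b : R) (p : R -> C) : a <= b -> pcont_on a b p ->
  ex_RInt (fun t => Re (p t)) a b /\ ex_RInt (fun t => Im (p t)) a b.
Proof.
intros hab H; split; apply (ex_RInt_continuous (V := R_CompleteNormedModule));
  rewrite Rmin_left, Rmax_right by exact hab; intros;
 [apply pcont_Re|apply pcont_Im]; auto.
Qed.

Lemma CInt_ext (a b : R) (p q : R -> C) : a <= b ->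
  (forall t, a <= t <= b -> p t = q t) -> CInt p a b = CInt q a b.
Proof.
intros hab H. unfold CInt. f_equal; apply RInt_ext;
  rewrite Rmin_left, Rmax_right by exact hab; intros; rewrite H; auto; lra.
Qed.

Lemma CInt_plus (a b : R) (p q : R -> C) : a <= b -> pcont_on a b p -> pcont_on a b q ->
  CInt (fun t => p t + q t)%C a b = (CInt p a b + CInt q a b)%C.
Proof.
intros hab Hp Hq.
destruct (pcont_on_ex_RInt a b p hab Hp). destruct (pcont_on_ex_RInt a b q hab Hq).
unfold CInt. apply injective_projections; simpl.
- exact (RInt_plus (V := R_CompleteNormedModule) (fun t => Re (p t)) (fun t => Re (q t)) a b H H1).
- exact (RInt_plus (V := R_CompleteNormedModule) (fun t => Im (p t)) (fun t => Im (q t)) a b H0 H2).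
Qed.

Lemma CInt_scal (a b : R) (c : C) (p : R -> C) : a <= b -> pcont_on a b p ->
  CInt (fun t => c * p t)%C a b = (c * CInt p a b)%C.
Proof.
intros hab Hp.
destruct (pcont_on_ex_RInt a b p hab Hp) as [H1 H2].
destruct c as [x y].
unfold CInt. apply injective_projections; simpl; apply is_RInt_unique.
- apply (is_RInt_minus (V := R_NormedModule) (fun t => x * Re (p t)) (fun t => y * Im (p t)));
  apply (is_RInt_scal (V := R_NormedModule)); apply (RInt_correct (V := R_CompleteNormedModule)); auto.
- apply (is_RInt_plus (V := R_NormedModule) (fun t => x * Im (p t)) (fun t => y * Re (p t)));
  apply (is_RInt_scal (V := R_NormedModule)); apply (RInt_correct (V := R_CompleteNormedModule)); auto.
Qed.

Lemma CInt_Chasles (a b c : R) (p : R -> C) : a <= b <= c -> pcont_on a c p ->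
  (CInt p a b + CInt p b c)%C = CInt p a c.
Proof.
intros habc Hp.
assert (Hp1 : pcont_on a b p) by (intros t Ht; apply Hp; lra).
assert (Hp2 : pcont_on b c p) by (intros t Ht; apply Hp; lra).
destruct (pcont_on_ex_RInt a b p) as [H1 H2]; [lra|auto|].
destruct (pcont_on_ex_RInt b c p) as [H3 H4]; [lra|auto|].
unfold CInt. apply injective_projections; simpl;
 apply (RInt_Chasles (V := R_CompleteNormedModule)); auto.
Qed.

Lemma CInt_const (a b : R) (c : C) : CInt (fun _ => c) a b = ((b - a)%R * c)%C.
Proof.
unfold CInt. rewrite 2!RInt_const. destruct c as [x y].
apply injective_projections; simpl; unfold scal; simpl; unfold mult; simpl; ring.
Qed.

Lemma RInt_abs_le_const (a b : R) (p : R -> R) (M : R) : a <= b -> ex_RInt p a b ->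
  (forall t, a <= t <= b -> Rabs (p t) <= M) -> Rabs (RInt p a b) <= (b - a) * M.
Proof.
intros hab Hp H.
apply (norm_RInt_le_const (V := R_NormedModule) p a b (RInt p a b) M hab H).
apply (RInt_correct (V := R_CompleteNormedModule)). exact Hp.
Qed.

(* The factor 2 comes from bounding the real and imaginary parts separately. *)
Lemma CInt_bound (a b : R) (p : R -> C) (M : R) : a <= b -> pcont_on a b p ->
  (forall t, a <= t <= b -> Cmod (p t) <= M) ->
  Cmod (CInt p a b) <= 2 * (M * (b - a)).
Proof.
intros hab Hp H. destruct (pcont_on_ex_RInt a b p hab Hp) as [H1 H2].
apply Rle_trans with (1 := Cmod_le_Re_Im _). simpl.
assert (K1 := RInt_abs_le_const a b _ M hab H1
  (fun t Ht => Rle_trans _ _ _ (Re_le_Cmod (p t)) (H t Ht))).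
assert (K2 := RInt_abs_le_const a b _ M hab H2
  (fun t Ht => Rle_trans _ _ _ (Im_le_Cmod (p t)) (H t Ht))).
lra.
Qed.

(** * Goursat's theorem on rectangles *)

Lemma pcont_const (c : C) (t : R) : pcont (fun _ => c) t.
Proof. apply continuous_pcont; apply continuous_const. Qed.

Lemma pcont_plus (p q : R -> C) (t : R) :
  pcont p t -> pcont q t -> pcont (fun s => p s + q s)%C t.
Proof.
intros Hp Hq.
apply continuous_pcont; simpl;
 apply (continuous_plus (V := R_NormedModule));
 auto using pcont_Re, pcont_Im.
Qed.

Lemma pcont_mult (p q : R -> C) (t : R) :
  pcont p t -> pcont q t -> pcont (fun s => p s * q s)%C t.
Proof.
intros Hp Hq.
apply continuous_pcont.
- apply (continuous_minus (V := R_NormedModule) (fun s => Re (p s) * Re (q s)) (fun s => Im (p s) * Im (q s)));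
  apply (continuous_mult (K := R_AbsRing)); auto using pcont_Re, pcont_Im.
- apply (continuous_plus (V := R_NormedModule) (fun s => Re (p s) * Im (q s)) (fun s => Im (p s) * Re (q s)));
  apply (continuous_mult (K := R_AbsRing)); auto using pcont_Re, pcont_Im.
Qed.

Lemma pcont_hor (y x : R) : pcont (fun s => (s, y)) x.
Proof. apply continuous_pcont; [apply continuous_id|apply continuous_const]. Qed.

Lemma pcont_ver (x y : R) : pcont (fun s => (x, s)) y.
Proof. apply continuous_pcont; [apply continuous_const|apply continuous_id]. Qed.

Lemma ccont_plus (f g : C -> C) (z : C) :
  ccont f z -> ccont g z -> ccont (fun w => f w + g w)%C z.
Proof.
intros Hf Hg eps He.
destruct (Hf (eps / 2)) as [d1 [Hd1 K1]]; [lra|].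
destruct (Hg (eps / 2)) as [d2 [Hd2 K2]]; [lra|].
exists (Rmin d1 d2). split; [apply Rmin_pos; lra|].
intros w Hw.
specialize (K1 w (Rlt_le_trans _ _ _ Hw (Rmin_l _ _))).
specialize (K2 w (Rlt_le_trans _ _ _ Hw (Rmin_r _ _))).
replace (f w + g w - (f z + g z))%C with ((f w - f z) + (g w - g z))%C by ring.
apply Rle_lt_trans with (1 := Cmod_triangle _ _). lra.
Qed.

Lemma cderiv_affine (al be z : C) : cderiv (fun w => al + be * w)%C z be.
Proof.
intros eps He. exists 1. split; [lra|]. intros w _.
replace (al + be * w - (al + be * z) - be * (w - z))%C with (RtoC 0) by ring.
rewrite Cmod_0. generalize (Cmod_ge_0 (w - z)). nra.
Qed.

Definition in_rect (a b c d : R) (z : C) : Prop :=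
  a <= Re z <= b /\ c <= Im z <= d.

(** The boundary is run counterclockwise: dz is dx on the horizontal sides and i dy on the vertical
    ones. *)
Definition rect_int (F : C -> C) (a b c d : R) : C :=
  (CInt (fun x => F (x, c)) a b - CInt (fun x => F (x, d)) a b
   + Ci * (CInt (fun y => F (b, y)) c d - CInt (fun y => F (a, y)) c d))%C.

Definition ccont_on_rect (F : C -> C) (a b c d : R) : Prop :=
  forall z, in_rect a b c d z -> ccont F z.

Lemma ccont_on_rect_hor (F : C -> C) (a b c d y : R) :
  ccont_on_rect F a b c d -> c <= y <= d -> pcont_on a b (fun x => F (x, y)).
Proof.
intros H Hy t Ht. apply (pcont_comp F (fun x => (x, y))); [|apply pcont_hor].
apply H. split; simpl; auto.
Qed.

Lemma ccont_on_rect_ver (F : C -> C) (a b c d x : R) :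
  ccont_on_rect F a b c d -> a <= x <= b -> pcont_on c d (fun y => F (x, y)).
Proof.
intros H Hx t Ht. apply (pcont_comp F (fun y => (x, y))); [|apply pcont_ver].
apply H. split; simpl; auto.
Qed.

(** The common vertical side is run in both directions and cancels; the horizontal sides add up. *)
Lemma rect_int_split_x (F : C -> C) (a m b c d : R) :
  a <= m <= b -> c <= d -> ccont_on_rect F a b c d ->
  rect_int F a b c d = (rect_int F a m c d + rect_int F m b c d)%C.
Proof.
intros H1 H2 HF. unfold rect_int.
rewrite <- (CInt_Chasles a m b (fun x => F (x, c)) H1) by (apply ccont_on_rect_hor with c d; auto; lra).
rewrite <- (CInt_Chasles a m b (fun x => F (x, d)) H1) by (apply ccont_on_rect_hor with c d; auto; lra).
ring.
Qed.

Lemma rect_int_split_y (F : C -> C) (a b c m d : R) :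
  a <= b -> c <= m <= d -> ccont_on_rect F a b c d ->
  rect_int F a b c d = (rect_int F a b c m + rect_int F a b m d)%C.
Proof.
intros H1 H2 HF. unfold rect_int.
rewrite <- (CInt_Chasles c m d (fun x => F (a, x)) H2) by (apply ccont_on_rect_ver with a b; auto; lra).
rewrite <- (CInt_Chasles c m d (fun x => F (b, x)) H2) by (apply ccont_on_rect_ver with a b; auto; lra).
ring.
Qed.

Lemma rect_int_plus (F G : C -> C) (a b c d : R) : a <= b -> c <= d ->
  ccont_on_rect F a b c d -> ccont_on_rect G a b c d ->
  rect_int (fun z => F z + G z)%C a b c d
  = (rect_int F a b c d + rect_int G a b c d)%C.
Proof.
intros H1 H2 HF HG. unfold rect_int.
rewrite (CInt_plus a b (fun x => F (x, c)) (fun x => G (x, c)) H1);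
 try (apply ccont_on_rect_hor with c d; auto; lra).
rewrite (CInt_plus a b (fun x => F (x, d)) (fun x => G (x, d)) H1);
 try (apply ccont_on_rect_hor with c d; auto; lra).
rewrite (CInt_plus c d (fun x => F (a, x)) (fun x => G (a, x)) H2);
 try (apply ccont_on_rect_ver with a b; auto; lra).
rewrite (CInt_plus c d (fun x => F (b, x)) (fun x => G (b, x)) H2);
 try (apply ccont_on_rect_ver with a b; auto; lra).
ring.
Qed.

Lemma RInt_id (a b : R) : is_RInt (fun t : R => t) a b ((b ^ 2 - a ^ 2) / 2).
Proof.
replace ((b ^ 2 - a ^ 2) / 2) with (minus (b ^ 2 / 2) (a ^ 2 / 2))
  by (unfold minus, plus, opp; simpl; field).
apply (is_RInt_derive (fun t => t ^ 2 / 2) (fun t => t)).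
- intros x _. auto_derive; [auto|field].
- intros x _. apply continuous_id.
Qed.

(** The midpoint rule is exact for affine integrands. *)
Lemma CInt_hor_affine (al be : C) (y a b : R) : a <= b ->
  CInt (fun x => al + be * (x, y))%C a b
  = ((b - a)%R * (al + be * (((a + b) / 2)%R, y)))%C.
Proof.
intros H.
assert (Hp : forall t, pcont (fun x => (x, y)) t) by (intro; apply pcont_hor).
rewrite (CInt_plus a b (fun _ => al) (fun x => be * (x, y))%C H).
2: intros t _; apply pcont_const.
2: intros t _; apply pcont_mult; [apply pcont_const|auto].
rewrite CInt_const, CInt_scal; auto. 2: intros t _; auto.
replace (CInt (fun x => (x, y)) a b) with ((b - a)%R * (((a + b) / 2)%R, y))%C. { ring. }
unfold CInt. simpl. rewrite RInt_const, (is_RInt_unique _ _ _ _ (RInt_id a b)).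
apply injective_projections; simpl; unfold scal; simpl; unfold mult; simpl; field.
Qed.

Lemma CInt_ver_affine (al be : C) (x a b : R) : a <= b ->
  CInt (fun y => al + be * (x, y))%C a b
  = ((b - a)%R * (al + be * (x, ((a + b) / 2)%R)))%C.
Proof.
intros H.
assert (Hp : forall t, pcont (fun y => (x, y)) t) by (intro; apply pcont_ver).
rewrite (CInt_plus a b (fun _ => al) (fun y => be * (x, y))%C H).
2: intros t _; apply pcont_const.
2: intros t _; apply pcont_mult; [apply pcont_const|auto].
rewrite CInt_const, (CInt_scal a b be (fun y => (x, y)) H). 2: intros t _; auto.
replace (CInt (fun y => (x, y)) a b) with ((b - a)%R * (x, ((a + b) / 2)%R))%C. { ring. }
unfold CInt. simpl. rewrite RInt_const, (is_RInt_unique _ _ _ _ (RInt_id a b)).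
apply injective_projections; simpl; unfold scal; simpl; unfold mult; simpl; field.
Qed.

(** Goursat's local step rests on this: the tangent map of F at a point contributes nothing, so only
    the error of differentiability is integrated. *)
Lemma rect_int_affine (al be : C) (a b c d : R) : a <= b -> c <= d ->
  rect_int (fun z => al + be * z)%C a b c d = 0.
Proof.
intros H1 H2. unfold rect_int.
rewrite !CInt_hor_affine, !CInt_ver_affine by assumption.
destruct al, be. apply injective_projections; simpl; field.
Qed.

(** The 4 is two parallel sides times the factor 2 of [CInt_bound]. *)
Lemma rect_int_bound (F : C -> C) (a b c d M : R) : a <= b -> c <= d ->
  ccont_on_rect F a b c d ->
  (forall z, in_rect a b c d z -> Cmod (F z) <= M) ->
  Cmod (rect_int F a b c d) <= 4 * (M * ((b - a) + (d - c))).
Proof.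
intros H1 H2 HF HM. unfold rect_int, Cminus.
assert (K : forall y, c <= y <= d -> Cmod (CInt (fun x => F (x, y)) a b) <= 2 * (M * (b - a))).
{ intros y Hy. apply CInt_bound; auto.
  - apply ccont_on_rect_hor with c d; auto.
  - intros t Ht. apply HM. split; simpl; auto. }
assert (K' : forall x, a <= x <= b -> Cmod (CInt (fun y => F (x, y)) c d) <= 2 * (M * (d - c))).
{ intros x Hx. apply CInt_bound; auto.
  - apply ccont_on_rect_ver with a b; auto.
  - intros t Ht. apply HM. split; simpl; auto. }
assert (Ka := K' a). assert (Kb := K' b). assert (Kc := K c). assert (Kd := K d).
apply Rle_trans with (1 := Cmod_triangle _ _). rewrite Cmod_mult, Cmod_Ci.
set (A := CInt (fun x => F (x, c)) a b) in *.
set (B := CInt (fun x => F (x, d)) a b) in *.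
set (P := CInt (fun x => F (a, x)) c d) in *.
set (Q := CInt (fun x => F (b, x)) c d) in *.
assert (T1 := Cmod_triangle A (- B)). assert (T2 := Cmod_triangle Q (- P)).
rewrite Cmod_opp in T1, T2.
assert (Ka' := Ka ltac:(lra)). assert (Kb' := Kb ltac:(lra)).
assert (Kc' := Kc ltac:(lra)). assert (Kd' := Kd ltac:(lra)). lra.
Qed.

Lemma rect_int_near_affine (F : C -> C) (al be : C) (a b c d M : R) : a <= b -> c <= d ->
  ccont_on_rect F a b c d ->
  (forall z, in_rect a b c d z -> Cmod (F z - (al + be * z)) <= M) ->
  Cmod (rect_int F a b c d) <= 4 * (M * ((b - a) + (d - c))).
Proof.
intros H1 H2 HF HM.
assert (HA : forall al be, ccont_on_rect (fun z => al + be * z)%C a b c d)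
 by (intros al' be' z _; apply cderiv_ccont with be'; apply cderiv_affine).
set (G := fun z => (F z + (- al + (- be) * z))%C).
assert (HG : ccont_on_rect G a b c d).
{ intros z Hz. apply ccont_plus; [auto|apply HA with (1 := Hz)]. }
replace (rect_int F a b c d) with (rect_int G a b c d).
- apply rect_int_bound; auto. intros z Hz.
  replace (G z) with (F z - (al + be * z))%C by (unfold G; ring). auto.
- unfold G. rewrite rect_int_plus; auto. rewrite rect_int_affine by auto. ring.
Qed.

(** * Bisection of rectangles *)

Record rect := Rect { rxl : R; rxr : R; ryl : R; ryr : R }.

Definition rect_size (r : rect) : R := (rxr r - rxl r) + (ryr r - ryl r).
Definition rect_ok (r : rect) : Prop := rxl r <= rxr r /\ ryl r <= ryr r.
Definition rect_sub (r s : rect) : Prop :=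
  rxl s <= rxl r /\ rxr r <= rxr s /\ ryl s <= ryl r /\ ryr r <= ryr s.
Definition half_rect (r s : rect) : Prop :=
  rect_ok r /\ rect_sub r s /\ rect_size r = rect_size s / 2.

Lemma nested_rects (r : nat -> rect) : rect_ok (r O) ->
  (forall n, half_rect (r (S n)) (r n)) ->
  exists x y, forall n, rxl (r n) <= x <= rxr (r n) /\ ryl (r n) <= y <= ryr (r n).
Proof.
intros H0 H.
assert (Hok : forall n, rect_ok (r n)) by (intros [|n]; [auto|apply H]).
assert (Hsub : forall k n, rect_sub (r (n + k)%nat) (r n)).
{ intros k n. induction k as [|k IH].
  - rewrite Nat.add_0_r. unfold rect_sub; lra.
  - rewrite Nat.add_succ_r. destruct (H (n + k)%nat) as [_ [K _]].
    unfold rect_sub in *. lra. }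
assert (Hx : forall m n, rxl (r m) <= rxr (r n) /\ ryl (r m) <= ryr (r n)).
{ intros m n. destruct (Hsub n m) as (A1 & A2 & A3 & A4).
  destruct (Hsub m n) as (B1 & B2 & B3 & B4). rewrite Nat.add_comm in B1, B2, B3, B4.
  destruct (Hok (m + n)%nat). lra. }
(* Every left end lies below every right end, so the supremum of the left ends belongs to all the
   intervals; likewise for the lower ends. *)
destruct (completeness (fun t => exists n, t = rxl (r n))) as [x [X1 X2]].
{ exists (rxr (r O)). intros t [n ->]. apply Hx. }
{ exists (rxl (r O)). now exists O. }
destruct (completeness (fun t => exists n, t = ryl (r n))) as [y [Y1 Y2]].
{ exists (ryr (r O)). intros t [n ->]. apply Hx. }
{ exists (ryl (r O)). now exists O. }
exists x, y. intros n. repeat split.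
- apply X1. now exists n.
- apply X2. intros t [m ->]. apply Hx.
- apply Y1. now exists n.
- apply Y2. intros t [m ->]. apply Hx.
Qed.

(** Compactness as an induction principle: a property inherited from the halves and true of small
    rectangles around each point is global. Otherwise failing rectangles of halving size shrink to a
    point where the local hypothesis applies. *)
Lemma rect_bisection (P : rect -> Prop) (r0 : rect) : rect_ok r0 ->
  (forall r, rect_ok r -> rect_sub r r0 ->
     (forall s, half_rect s r -> P s) -> P r) ->
  (forall x y, rxl r0 <= x <= rxr r0 -> ryl r0 <= y <= ryr r0 ->
     exists delta, 0 < delta /\
       forall r, rect_ok r -> rect_sub r r0 ->
         rxl r <= x <= rxr r -> ryl r <= y <= ryr r -> rect_size r < delta -> P r) ->
  P r0.
Proof.
intros Hok Hstep Hloc. apply NNPP. intros HP.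
(* The conditions stand inside the existential so that choice yields a total function [next]. *)
assert (Hn : forall r, exists s, rect_ok r -> rect_sub r r0 -> ~ P r -> half_rect s r /\ ~ P s).
{ intros r. apply NNPP. intros Hno. apply Hno. exists r. intros H1 H2 H3. exfalso.
  apply H3. apply Hstep; auto. intros s Hs. apply NNPP. intros Hs'. apply Hno.
  exists s. auto. }
set (next := fun r => proj1_sig (constructive_indefinite_description _ (Hn r))).
assert (Hnext : forall r, rect_ok r -> rect_sub r r0 -> ~ P r -> half_rect (next r) r /\ ~ P (next r))
  by (intros r; exact (proj2_sig (constructive_indefinite_description _ (Hn r)))).
clearbody next.
set (seq := fix seq n := match n with O => r0 | S m => next (seq m) end).
assert (Hseq : forall n, rect_ok (seq n) /\ rect_sub (seq n) r0 /\ ~ P (seq n)).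
{ induction n as [|n [I1 [I2 I3]]].
  - split; [exact Hok|]. split; [unfold rect_sub; simpl; lra|exact HP].
  - destruct (Hnext _ I1 I2 I3) as [[K1 [K2 _]] K3].
    split; [exact K1|]. split; [|exact K3].
    simpl. unfold rect_sub in *. lra. }
assert (Hhalf : forall n, half_rect (seq (S n)) (seq n)).
{ intros n. destruct (Hseq n) as [I1 [I2 I3]]. apply (Hnext _ I1 I2 I3). }
destruct (nested_rects seq) as [x [y Hxy]]; [exact Hok|exact Hhalf|].
destruct (Hloc x y) as [delta [Hd Hl]]; [apply (Hxy O)..|].
assert (Hsize : forall n, rect_size (seq n) = rect_size r0 * (1 / 2) ^ n).
{ induction n as [|n IH]; simpl; [ring|].
  destruct (Hhalf n) as [_ [_ K]]. simpl in K. rewrite K, IH. field. }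
assert (Hs0 : 0 <= rect_size r0) by (destruct Hok; unfold rect_size; lra).
(* The + 1 keeps the denominator positive when the rectangle is degenerate. *)
destruct (pow_lt_1_zero (1 / 2)) with (y := delta / (rect_size r0 + 1)) as [n Hn'].
{ rewrite Rabs_pos_eq; lra. }
{ apply Rdiv_lt_0_compat; lra. }
destruct (Hseq n) as [K1 [K2 K3]]. apply K3. apply Hl; auto; try apply Hxy.
rewrite Hsize. specialize (Hn' n (le_n n)).
assert (Hpos : 0 < (1 / 2) ^ n) by (apply pow_lt; lra).
rewrite Rabs_pos_eq in Hn' by lra.
apply Rmult_lt_compat_l with (r := rect_size r0 + 1) in Hn'; [|lra].
replace ((rect_size r0 + 1) * (delta / (rect_size r0 + 1))) with delta in Hn' by (field; lra).
lra.
Qed.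

Theorem goursat_rect (F : C -> C) (a b c d : R) : a <= b -> c <= d ->
  (forall z, in_rect a b c d z -> exists l, cderiv F z l) ->
  rect_int F a b c d = 0.
Proof.
intros Hab Hcd HF.
assert (HC : ccont_on_rect F a b c d).
{ intros z Hz. destruct (HF z Hz) as [l Hl]. now apply cderiv_ccont with l. }
set (S0 := (b - a) + (d - c)).
assert (HS0 : 0 <= S0) by (unfold S0; lra).
(* The bound is quadratic in the size: four parts of half the size have bounds that sum to exactly
   the bound of the whole, so it passes through bisection. *)
assert (Key : forall eps, 0 < eps -> Cmod (rect_int F a b c d) <= eps * (4 * S0 ^ 2)).
{ intros eps He.
  apply (rect_bisection (fun r => Cmod (rect_int F (rxl r) (rxr r) (ryl r) (ryr r))
           <= eps * (4 * rect_size r ^ 2)) (Rect a b c d)).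
  - split; simpl; auto.
  - intros [a' b' c' d'] [H1 H2] (S1 & S2 & S3 & S4) Hq; simpl in *.
    assert (HC' : ccont_on_rect F a' b' c' d').
    { intros z [Z1 Z2]. apply HC. split; lra. }
    set (m := (a' + b') / 2). set (n := (c' + d') / 2).
    assert (Hm : a' <= m <= b') by (unfold m; lra).
    assert (Hn : c' <= n <= d') by (unfold n; lra).
    rewrite (rect_int_split_x F a' m b' c' d') by auto.
    rewrite (rect_int_split_y F a' m c' n d'); [|lra|auto|].
    2: intros z [Z1 Z2]; apply HC'; split; lra.
    rewrite (rect_int_split_y F m b' c' n d'); [|lra|auto|].
    2: intros z [Z1 Z2]; apply HC'; split; lra.
    assert (Q1 := Hq (Rect a' m c' n)). assert (Q2 := Hq (Rect a' m n d')).
    assert (Q3 := Hq (Rect m b' c' n)). assert (Q4 := Hq (Rect m b' n d')).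
    unfold half_rect, rect_ok, rect_sub, rect_size in *; simpl in *.
    assert (E : m - a' = (b' - a') / 2) by (unfold m; field).
    assert (E' : b' - m = (b' - a') / 2) by (unfold m; field).
    assert (E2 : n - c' = (d' - c') / 2) by (unfold n; field).
    assert (E2' : d' - n = (d' - c') / 2) by (unfold n; field).
    specialize (Q1 ltac:(repeat split; lra)). specialize (Q2 ltac:(repeat split; lra)).
    specialize (Q3 ltac:(repeat split; lra)). specialize (Q4 ltac:(repeat split; lra)).
    rewrite E, E2 in Q1. rewrite E, E2' in Q2. rewrite E', E2 in Q3. rewrite E', E2' in Q4.
    apply Rle_trans with (1 := Cmod_triangle _ _).
    apply Rle_trans with (1 := Rplus_le_compat _ _ _ _ (Cmod_triangle _ _) (Cmod_triangle _ _)).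
    lra.
  - simpl. intros x y Hx Hy.
    destruct (HF (x, y)) as [l Hl]; [split; auto|].
    destruct (Hl eps He) as [delta [Hd H]].
    exists delta. split; [exact Hd|].
    intros [a' b' c' d'] [H1 H2] (S1 & S2 & S3 & S4) Hx' Hy' Hs; unfold rect_size in *; simpl in *.
    set (s := b' - a' + (d' - c')) in *.
    replace (eps * (4 * (s * (s * 1)))) with (4 * ((eps * s) * s)) by ring.
    (* The affine function is the tangent map at (x, y); the error is at most eps times the size s,
       and the boundary length supplies the second factor s. *)
    apply (rect_int_near_affine F (F (x, y) - l * (x, y)) l); auto.
    + intros z [Z1 Z2]; apply HC; split; lra.
    + intros z [Z1 Z2].
      assert (Hz : Cmod (z - (x, y)) <= s).
      { apply Rle_trans with (1 := Cmod_le_Re_Im _). destruct z as [zx zy]; simpl in *.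
        unfold s. apply Rplus_le_compat; apply Rabs_le; lra. }
      replace (F z - (F (x, y) - l * (x, y) + l * z))%C
        with (F z - F (x, y) - l * (z - (x, y)))%C by ring.
      apply Rle_trans with (1 := H z (Rle_lt_trans _ _ _ Hz Hs)).
      apply Rmult_le_compat_l; lra. }
apply Cmod_eq_0. apply Rle_antisym; [|apply Cmod_ge_0].
apply Rle_plus_epsilon. intros eps He. rewrite Rplus_0_l.
assert (HS2 : 0 < 4 * S0 ^ 2 + 1) by nra.
apply Rle_trans with (1 := Key (eps / (4 * S0 ^ 2 + 1)) (Rdiv_lt_0_compat _ _ He HS2)).
apply Rle_trans with (eps / (4 * S0 ^ 2 + 1) * (4 * S0 ^ 2 + 1)).
- apply Rmult_le_compat_l; [|lra]. apply Rlt_le, Rdiv_lt_0_compat; auto.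
- right. field. lra.
Qed.

(** * Integrals over circles *)

Lemma derivable_pt_lim_approx (f : R -> R) (x l : R) : derivable_pt_lim f x l ->
  forall eps, 0 < eps -> exists delta, 0 < delta /\
    forall h, Rabs h < delta -> Rabs (f (x + h) - f x - l * h) <= eps * Rabs h.
Proof.
intros H eps He. destruct (H eps He) as [d Hd]. exists d. split; [apply cond_pos|].
intros h Hh. destruct (Req_dec h 0) as [->|Hh0].
- rewrite Rplus_0_r, Rabs_R0. replace (f x - f x - l * 0) with 0 by ring. rewrite Rabs_R0. lra.
- specialize (Hd h Hh0 Hh).
  replace (f (x + h) - f x - l * h) with (((f (x + h) - f x) / h - l) * h) by (field; auto).
  rewrite Rabs_mult. apply Rmult_le_compat_r; [apply Rabs_pos|lra].
Qed.

Definition circ (r t : R) : C := (r * cos t, r * sin t).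
Definition cexp (z : C) : C := circ (exp (Re z)) (Im z).

Lemma Cmod_circ (r t : R) : 0 <= r -> Cmod (circ r t) = r.
Proof.
intros Hr. unfold Cmod, circ; simpl.
replace (r * cos t * (r * cos t * 1) + r * sin t * (r * sin t * 1)) with (r * r).
- apply sqrt_square. exact Hr.
- generalize (sin2_cos2 t); unfold Rsqr. intros E.
  transitivity (r * r * (sin t * sin t + cos t * cos t)); [rewrite E|]; ring.
Qed.

Lemma Cmod_cexp (z : C) : Cmod (cexp z) = exp (Re z).
Proof. apply Cmod_circ, Rlt_le, exp_pos. Qed.

Lemma exp_le_compat (x y : R) : x <= y -> exp x <= exp y.
Proof. intros [H| ->]; [left; now apply exp_increasing|right; reflexivity]. Qed.

Lemma cexp_plus (z w : C) : cexp (z + w) = (cexp z * cexp w)%C.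
Proof.
destruct z as [x y], w as [x' y']. unfold cexp, circ. simpl.
rewrite exp_plus, cos_plus, sin_plus. apply injective_projections; simpl; ring.
Qed.

(** Differentiability of [cexp] at 0, which [cexp_plus] then carries to every point. *)
Lemma cexp_approx (eps : R) : 0 < eps -> exists delta, 0 < delta /\
  forall h, Cmod h < delta -> Cmod (cexp h - 1 - h) <= eps * Cmod h.
Proof.
(* With X = |x| and Y = |y|, the error terms below cost e X, 2 e Y, 4 e Y and e Y, at most 8 e |h|
   in all. The bound e <= 1/8 keeps |1 + x| below 2. *)
intros He. set (e := Rmin eps 1 / 8).
assert (He0 : 0 < e) by (unfold e; generalize (Rmin_pos eps 1); lra).
assert (He1 : e <= 1 / 8) by (unfold e; generalize (Rmin_r eps 1); lra).
assert (He2 : 8 * e <= eps) by (unfold e; generalize (Rmin_l eps 1); lra).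
destruct (derivable_pt_lim_approx _ _ _ (derivable_pt_lim_exp 0) e He0) as [d1 [Hd1 K1]].
destruct (derivable_pt_lim_approx _ _ _ (derivable_pt_lim_cos 0) e He0) as [d2 [Hd2 K2]].
destruct (derivable_pt_lim_approx _ _ _ (derivable_pt_lim_sin 0) e He0) as [d3 [Hd3 K3]].
exists (Rmin (Rmin d1 d2) (Rmin d3 e)). split; [repeat apply Rmin_pos; auto|].
intros [x y] Hh.
assert (H1 := Rlt_le_trans _ _ _ Hh (Rmin_l _ _)).
assert (H2 := Rlt_le_trans _ _ _ Hh (Rmin_r _ _)).
assert (L1 := Rlt_le_trans _ _ _ H1 (Rmin_l _ _)).
assert (L2 := Rlt_le_trans _ _ _ H1 (Rmin_r _ _)).
assert (L3 := Rlt_le_trans _ _ _ H2 (Rmin_l _ _)).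
assert (L4 := Rlt_le_trans _ _ _ H2 (Rmin_r _ _)).
assert (Hx := Re_le_Cmod (x, y)). assert (Hy := Im_le_Cmod (x, y)). simpl in Hx, Hy.
specialize (K1 x ltac:(lra)). specialize (K2 y ltac:(lra)). specialize (K3 y ltac:(lra)).
rewrite Rplus_0_l, exp_0 in K1. rewrite Rplus_0_l, cos_0, sin_0 in K2. rewrite Rplus_0_l, sin_0, cos_0 in K3.
set (m := Cmod (x, y)) in *. assert (Hm := Cmod_ge_0 (x, y)). fold m in Hm.
set (X := Rabs x) in *. set (Y := Rabs y) in *.
assert (HX := Rabs_pos x). assert (HY := Rabs_pos y). fold X in HX. fold Y in HY.
apply Rle_trans with (1 := Cmod_le_Re_Im _). simpl.
set (A := exp x - 1 - 1 * x) in *. set (B := cos y - 1 - - 0 * y) in *.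
set (D := sin y - 0 - 1 * y) in *.
replace (exp x * cos y + - (1) + - x) with (A * cos y + (1 + x) * B) by (unfold A, B; ring).
replace (exp x * sin y + - 0 + - y) with ((A + x) * (D + y) + D) by (unfold A, D; ring).
assert (T1 : Rabs (A * cos y + (1 + x) * B) <= e * X + 2 * (e * Y)).
{ apply Rle_trans with (1 := Rabs_triang _ _). rewrite !Rabs_mult.
  assert (Hc : Rabs (cos y) <= 1) by (apply Rabs_le; generalize (COS_bound y); lra).
  assert (H1x : Rabs (1 + x) <= 2).
  { apply Rle_trans with (1 := Rabs_triang _ _). rewrite Rabs_R1. fold X. lra. }
  apply Rplus_le_compat.
  - replace (e * X) with (e * X * 1) by ring. apply Rmult_le_compat; auto using Rabs_pos.
  - apply Rmult_le_compat; auto using Rabs_pos. }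
assert (T2 : Rabs ((A + x) * (D + y) + D) <= (2 * e) * (2 * Y) + e * Y).
{ apply Rle_trans with (1 := Rabs_triang _ _). rewrite !Rabs_mult.
  apply Rplus_le_compat; [|exact K3].
  apply Rmult_le_compat; auto using Rabs_pos.
  - apply Rle_trans with (1 := Rabs_triang _ _). fold X. nra.
  - apply Rle_trans with (1 := Rabs_triang _ _). fold Y. nra. }
apply Rle_trans with (e * X + 2 * (e * Y) + (2 * e * (2 * Y) + e * Y)); [lra|].
apply Rle_trans with (8 * e * m); [nra|nra].
Qed.

Lemma cderiv_cexp (z : C) : cderiv cexp z (cexp z).
Proof.
intros eps He.
assert (Hp : 0 < Cmod (cexp z)) by (rewrite Cmod_cexp; apply exp_pos).
destruct (cexp_approx (eps / Cmod (cexp z))) as [d [Hd H]].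
{ now apply Rdiv_lt_0_compat. }
exists d; split; auto. intros w Hw.
replace w with (z + (w - z))%C at 1 by ring. rewrite cexp_plus.
replace (cexp z * cexp (w - z) - cexp z - cexp z * (w - z))%C
  with (cexp z * (cexp (w - z) - 1 - (w - z)))%C by ring.
rewrite Cmod_mult.
apply Rle_trans with (1 := Rmult_le_compat_l _ _ _ (Rlt_le _ _ Hp) (H _ Hw)).
right. field. lra.
Qed.

Lemma cderiv_comp (f g : C -> C) (z lf lg : C) :
  cderiv f (g z) lf -> cderiv g z lg -> cderiv (fun w => f (g w)) z (lg * lf).
Proof.
intros Hf Hg. apply is_derive_cderiv in Hf. apply is_derive_cderiv in Hg.
apply is_derive_cderiv.
exact (is_derive_comp (K := C_AbsRing) (V := AbsRing_NormedModule C_AbsRing) f g z lf lg Hf Hg).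
Qed.

Lemma cderiv_mult (f g : C -> C) (z lf lg : C) :
  cderiv f z lf -> cderiv g z lg ->
  cderiv (fun w => f w * g w)%C z (lf * g z + f z * lg).
Proof.
intros Hf Hg. apply is_derive_cderiv in Hf. apply is_derive_cderiv in Hg.
apply is_derive_cderiv.
exact (is_derive_mult (K := C_AbsRing) f g z lf lg Hf Hg Cmult_comm).
Qed.

Lemma ccont_mult (f g : C -> C) (z : C) :
  ccont f z -> ccont g z -> ccont (fun w => f w * g w)%C z.
Proof.
intros Hf Hg eps He.
set (A := Cmod (f z)). set (B := Cmod (g z)).
assert (HA : 0 <= A) by apply Cmod_ge_0. assert (HB : 0 <= B) by apply Cmod_ge_0.
set (e := Rmin 1 (eps / (A + B + 2))).
assert (He0 : 0 < e) by (apply Rmin_pos; [lra|apply Rdiv_lt_0_compat; lra]).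
assert (He1 : e <= 1) by apply Rmin_l.
assert (He2 : e * (A + B + 2) <= eps).
{ apply Rle_trans with (eps / (A + B + 2) * (A + B + 2)).
  - apply Rmult_le_compat_r; [lra|apply Rmin_r].
  - right; field; lra. }
destruct (Hf e He0) as [d1 [Hd1 K1]]. destruct (Hg e He0) as [d2 [Hd2 K2]].
exists (Rmin d1 d2). split; [apply Rmin_pos; lra|].
intros w Hw.
specialize (K1 w (Rlt_le_trans _ _ _ Hw (Rmin_l _ _))).
specialize (K2 w (Rlt_le_trans _ _ _ Hw (Rmin_r _ _))).
replace (f w * g w - f z * g z)%C
  with ((f w - f z) * (g w - g z) + ((f w - f z) * g z + f z * (g w - g z)))%C by ring.
apply Rle_lt_trans with (1 := Cmod_triangle _ _).
apply Rle_lt_trans with (1 := Rplus_le_compat_l _ _ _ (Cmod_triangle _ _)).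
rewrite !Cmod_mult. fold A B.
generalize (Cmod_ge_0 (f w - f z)) (Cmod_ge_0 (g w - g z)). intros. nra.
Qed.

Lemma pcont_circ (r t : R) : pcont (circ r) t.
Proof.
apply continuous_pcont; apply (continuous_mult (K := R_AbsRing));
 try apply continuous_const; apply continuity_pt_filterlim; reg.
Qed.

Lemma CInt_minus (a b : R) (p q : R -> C) : a <= b -> pcont_on a b p -> pcont_on a b q ->
  CInt (fun t => p t - q t)%C a b = (CInt p a b - CInt q a b)%C.
Proof.
intros hab Hp Hq.
rewrite (CInt_ext a b _ (fun t => p t + (- (1)) * q t)%C); [|auto|intros; ring].
rewrite CInt_plus, CInt_scal; auto; [ring|].
intros t Ht. apply pcont_mult; [apply pcont_const|auto].
Qed.

(** The integral is taken against the angle. Since dz = i z dt, the contour integral of q is i times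
    [circle_int] of q(z) z, which is why the factor z appears below. *)
Definition circle_int (g : C -> C) (r : R) : C :=
  CInt (fun t => g (circ r t)) 0 (2 * PI).

Lemma two_PI_ge_0 : 0 <= 2 * PI.
Proof. generalize PI_RGT_0; lra. Qed.

Lemma circ_exp (s t : R) : circ (exp s) t = cexp (s, t).
Proof. reflexivity. Qed.

Lemma circle_int_const (q : C -> C) (r1 r2 : R) : 0 < r1 <= r2 ->
  (forall z, r1 <= Cmod z <= r2 -> exists l, cderiv q z l) ->
  circle_int (fun z => q z * z)%C r1 = circle_int (fun z => q z * z)%C r2.
Proof.
intros Hr Hq.
set (F := fun z => (q (cexp z) * cexp z)%C).
assert (HF : rect_int F (ln r1) (ln r2) 0 (2 * PI) = 0).
{ apply goursat_rect.
  - destruct (Req_dec r1 r2) as [->|]; [lra|]. apply Rlt_le, ln_increasing; lra.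
  - exact two_PI_ge_0.
  - intros z [[H1 H2] _]. destruct (Hq (cexp z)) as [l Hl].
    { rewrite Cmod_cexp. rewrite <- (exp_ln r1), <- (exp_ln r2) by lra.
      split; apply exp_le_compat; assumption. }
    eexists. apply cderiv_mult; [apply cderiv_comp|]; try apply cderiv_cexp.
    exact Hl. }
unfold rect_int in HF.
(* By periodicity of [cexp] the two horizontal sides agree and cancel; the vertical sides are the
   two circle integrals. *)
rewrite (CInt_ext _ _ (fun x => F (x, 2 * PI)) (fun x => F (x, 0))) in HF.
2: { destruct (Req_dec r1 r2) as [->|]; [lra|]. apply Rlt_le, ln_increasing; lra. }
2: { intros t _. unfold F, cexp, circ; simpl. rewrite cos_2PI, sin_2PI, cos_0, sin_0. reflexivity. }
replace (CInt (fun y => F (ln r1, y)) 0 (2 * PI))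
  with (circle_int (fun z => q z * z)%C r1) in HF.
2: { unfold circle_int, F. apply CInt_ext; [apply two_PI_ge_0|]. intros t _.
     rewrite <- circ_exp, exp_ln by lra. reflexivity. }
replace (CInt (fun y => F (ln r2, y)) 0 (2 * PI))
  with (circle_int (fun z => q z * z)%C r2) in HF.
2: { unfold circle_int, F. apply CInt_ext; [apply two_PI_ge_0|]. intros t _.
     rewrite <- circ_exp, exp_ln by lra. reflexivity. }
set (A := circle_int _ r1) in *. set (B := circle_int _ r2) in *.
set (D := CInt _ _ _) in HF.
assert (E : (Ci * (B - A))%C = 0) by (rewrite <- HF; ring).
(* The factor i in front of the vertical sides is removed by multiplying by its inverse -i. *)
assert (E' : (B - A)%C = (- Ci * (Ci * (B - A)))%C)
  by (destruct A, B; apply injective_projections; simpl; ring).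
rewrite E in E'. replace A with (B - (B - A))%C by ring. rewrite E'. ring.
Qed.

Lemma continuity_2d_pt_circ (g : C -> C) (r t : R) : ccont g (circ r t) ->
  continuity_2d_pt (fun u v => Re (g (circ v u))) t r /\
  continuity_2d_pt (fun u v => Im (g (circ v u))) t r.
Proof.
intros Hg.
assert (H1 : continuity_2d_pt (fun u v => v * cos u) t r).
{ apply continuity_2d_pt_mult; [apply continuity_2d_pt_id2|].
  apply (continuity_1d_2d_pt_comp cos (fun u v => u)); [reg|apply continuity_2d_pt_id1]. }
assert (H2 : continuity_2d_pt (fun u v => v * sin u) t r).
{ apply continuity_2d_pt_mult; [apply continuity_2d_pt_id2|].
  apply (continuity_1d_2d_pt_comp sin (fun u v => u)); [reg|apply continuity_2d_pt_id1]. }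
assert (H : forall eps : posreal, locally_2d (fun u v => Cmod (g (circ v u) - g (circ r t)) < eps) t r).
{ intros eps. destruct (Hg eps (cond_pos eps)) as [d [Hd Hgd]].
  assert (Hd2 : 0 < d / 2) by lra.
  destruct (H1 (mkposreal _ Hd2)) as [d1 K1]. destruct (H2 (mkposreal _ Hd2)) as [d2 K2].
  exists (mkposreal _ (Rmin_pos _ _ (cond_pos d1) (cond_pos d2))). simpl. intros u v Hu Hv.
  apply Hgd. apply Rle_lt_trans with (1 := Cmod_le_Re_Im _).
  specialize (K1 u v (Rlt_le_trans _ _ _ Hu (Rmin_l _ _)) (Rlt_le_trans _ _ _ Hv (Rmin_l _ _))).
  specialize (K2 u v (Rlt_le_trans _ _ _ Hu (Rmin_r _ _)) (Rlt_le_trans _ _ _ Hv (Rmin_r _ _))).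
  simpl in *. unfold Rminus in *. lra. }
split; intros eps; destruct (H eps) as [d Hd]; exists d; intros u v Hu Hv;
 apply Rle_lt_trans with (2 := Hd u v Hu Hv).
- exact (Re_le_Cmod (g (circ v u) - g (circ r t))).
- exact (Im_le_Cmod (g (circ v u) - g (circ r t))).
Qed.

(** The angles form a compact interval, so continuity of g along the circle of radius r0 is uniform
    in the angle as the radius varies. *)
Lemma circle_int_continuous (g : C -> C) (R0 r0 : R) : 0 <= r0 < R0 ->
  (forall z, Cmod z < R0 -> ccont g z) ->
  forall eps, 0 < eps -> exists delta, 0 < delta /\
    forall r, 0 <= r < R0 -> Rabs (r - r0) < delta ->
      Cmod (circle_int g r - circle_int g r0) < eps.
Proof.
intros Hr0 Hg eps He.
assert (HP := PI_RGT_0).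
(* Two components, the factor 2 of [CInt_bound] and the length 2 pi give 8 pi e, which is eps /
   2. *)
set (e := eps / (16 * PI)).
assert (He0 : 0 < e) by (apply Rdiv_lt_0_compat; lra).
assert (Hc : forall t, ccont g (circ r0 t)) by (intros t; apply Hg; rewrite Cmod_circ; lra).
destruct (uniform_continuity_2d_1d (fun u v => Re (g (circ v u))) 0 (2 * PI) r0)
  with (eps := mkposreal e He0) as [d1 K1].
{ intros t _. apply continuity_2d_pt_circ, Hc. }
destruct (uniform_continuity_2d_1d (fun u v => Im (g (circ v u))) 0 (2 * PI) r0)
  with (eps := mkposreal e He0) as [d2 K2].
{ intros t _. apply continuity_2d_pt_circ, Hc. }
simpl in K1, K2.
exists (Rmin d1 d2). split; [apply Rmin_pos; apply cond_pos|].
intros r Hr Hrr.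
assert (L1 := Rlt_le_trans _ _ _ Hrr (Rmin_l _ _)). apply Rabs_def2 in L1.
assert (L2 := Rlt_le_trans _ _ _ Hrr (Rmin_r _ _)). apply Rabs_def2 in L2.
assert (Hp : forall s, 0 <= s < R0 -> pcont_on 0 (2 * PI) (fun t => g (circ s t))).
{ intros s Hs t _. apply (pcont_comp g (circ s)); [|apply pcont_circ].
  apply Hg. rewrite Cmod_circ; lra. }
unfold circle_int. rewrite <- CInt_minus; auto using two_PI_ge_0.
apply Rle_lt_trans with (2 * (2 * e * (2 * PI - 0))).
- apply CInt_bound; [apply two_PI_ge_0| |].
  + intros t Ht.
    assert (E : forall s, 0 <= s < R0 -> pcont (fun t => g (circ s t)) t) by (intros; apply Hp; auto).
    apply continuous_pcont;
     apply (continuous_minus (V := R_NormedModule));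
     auto using pcont_Re, pcont_Im.
  + intros t Ht. apply Rle_trans with (1 := Cmod_le_Re_Im _).
    assert (Z1 := cond_pos d1). assert (Z2 := cond_pos d2).
    assert (A1 := K1 t r0 t r Ht ltac:(lra) Ht ltac:(lra)).
    assert (A2 := K2 t r0 t r Ht ltac:(lra) Ht ltac:(lra)).
    rewrite Rminus_diag_eq, Rabs_R0 in A1, A2 by reflexivity.
    specialize (A1 Z1). specialize (A2 Z2).
    simpl. unfold Rminus in *. unfold Re, Im in *. lra.
- unfold e. replace (2 * (2 * (eps / (16 * PI)) * (2 * PI - 0))) with (eps / 2) by (field; lra). lra.
Qed.

Lemma eq_at_endpoints (J : R -> C) (a b : R) : a < b ->
  (forall r0, a <= r0 <= b -> forall eps, 0 < eps -> exists delta, 0 < delta /\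
    forall r, a <= r <= b -> Rabs (r - r0) < delta -> Cmod (J r - J r0) < eps) ->
  (forall r1 r2, a < r1 <= r2 -> r2 < b -> J r1 = J r2) -> J a = J b.
Proof.
intros Hab HJ Hc.
assert (Cmod (J a - J b) = 0).
{ apply Rle_antisym; [|apply Cmod_ge_0]. apply Rle_plus_epsilon. intros eps He.
  destruct (HJ a ltac:(lra) (eps / 2) ltac:(lra)) as [d1 [Hd1 K1]].
  destruct (HJ b ltac:(lra) (eps / 2) ltac:(lra)) as [d2 [Hd2 K2]].
  set (e := Rmin (Rmin d1 d2) (b - a) / 2).
  assert (E0 : 0 < e) by (unfold e; generalize (Rmin_pos _ (b - a) (Rmin_pos _ _ Hd1 Hd2)); lra).
  assert (E1 : e <= Rmin d1 d2 / 2) by (unfold e; generalize (Rmin_l (Rmin d1 d2) (b - a)); lra).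
  assert (E2 : e <= (b - a) / 2) by (unfold e; generalize (Rmin_r (Rmin d1 d2) (b - a)); lra).
  generalize (Rmin_l d1 d2) (Rmin_r d1 d2). intros.
  specialize (K1 (a + e) ltac:(lra) ltac:(apply Rabs_def1; lra)).
  specialize (K2 (b - e) ltac:(lra) ltac:(apply Rabs_def1; lra)).
  rewrite (Hc (a + e) (b - e)) in K1 by lra.
  replace (J a - J b)%C with (- (J (b - e)%R - J a) + (J (b - e)%R - J b))%C by ring.
  apply Rle_trans with (1 := Cmod_triangle _ _). rewrite Cmod_opp. lra. }
apply Cmod_eq_0 in H. replace (J a) with ((J a - J b) + J b)%C by ring. rewrite H. ring.
Qed.

(** The point w lies on the single circle |z| = |w|, so the integral is constant for radii in (0,
    |w|) and in (|w|, r). Continuity joins these pieces across |w| and down to radius 0, where the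
    factor z makes the integrand zero. *)
Lemma circle_int_zero (q : C -> C) (w : C) (R0 r : R) : Cmod w < r < R0 ->
  (forall z, Cmod z < R0 -> ccont q z) ->
  (forall z, Cmod z < R0 -> z <> w -> exists l, cderiv q z l) ->
  circle_int (fun z => q z * z)%C r = 0.
Proof.
intros Hr Hc Hd.
assert (Hw := Cmod_ge_0 w).
set (g := fun z => (q z * z)%C).
assert (Hg : forall z, Cmod z < R0 -> ccont g z).
{ intros z Hz. apply ccont_mult; [auto|]. apply cderiv_ccont with (RtoC 1).
  intros eps He. exists 1. split; [lra|]. intros v _.
  replace (v - z - 1 * (v - z))%C with (RtoC 0) by ring. rewrite Cmod_0.
  generalize (Cmod_ge_0 (v - z)). nra. }
assert (HJ : forall a b, 0 <= a -> b < R0 -> forall r0, a <= r0 <= b -> forall eps, 0 < eps ->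
  exists delta, 0 < delta /\
    forall r, a <= r <= b -> Rabs (r - r0) < delta -> Cmod (circle_int g r - circle_int g r0) < eps).
{ intros a b Ha Hb r0 Hr0 eps He.
  destruct (circle_int_continuous g R0 r0) with (eps := eps) as [d [Hd0 H]]; auto; [lra|].
  exists d; split; auto. intros s Hs. apply H. lra. }
assert (H1 : circle_int g (Cmod w) = circle_int g r).
{ apply eq_at_endpoints; [lra|apply HJ; lra|].
  intros r1 r2 H1 H2. apply circle_int_const; [lra|]. intros z Hz. apply Hd; [lra|].
  intros ->. lra. }
assert (H2 : circle_int g 0 = circle_int g (Cmod w)).
{ destruct (Req_dec (Cmod w) 0) as [->|Hw0]; [reflexivity|].
  apply eq_at_endpoints; [lra|apply HJ; lra|].
  intros r1 r2 K1 K2. apply circle_int_const; [lra|]. intros z Hz. apply Hd; [lra|].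
  intros ->. lra. }
rewrite <- H1, <- H2. unfold circle_int.
rewrite (CInt_ext _ _ _ (fun _ => RtoC 0)).
- rewrite CInt_const. ring.
- apply two_PI_ge_0.
- intros t _. unfold g. replace (circ 0 t) with (RtoC 0); [ring|].
  unfold circ. apply injective_projections; simpl; ring.
Qed.

(** * Cauchy's formula and Taylor expansions *)

Lemma cderiv_ext_loc (f g : C -> C) (z l : C) (d : R) : 0 < d ->
  (forall w, Cmod (w - z) < d -> f w = g w) -> cderiv f z l -> cderiv g z l.
Proof.
intros Hd Hfg Hf eps He. destruct (Hf eps He) as [d' [Hd' H]].
exists (Rmin d d'). split; [now apply Rmin_pos|]. intros w Hw.
rewrite <- !Hfg.
- apply H. apply Rlt_le_trans with (1 := Hw). apply Rmin_r.
- replace (z - z)%C with (RtoC 0) by ring. now rewrite Cmod_0.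
- apply Rlt_le_trans with (1 := Hw). apply Rmin_l.
Qed.

Lemma Cmod_sub_pos (z w : C) : z <> w -> 0 < Cmod (z - w).
Proof.
intros H. apply Cmod_gt_0. intros E. apply H.
replace z with ((z - w) + w)%C by ring. rewrite E. ring.
Qed.

Lemma Cmod_sub_lt_neq (z w : C) (d : R) : Cmod (w - z) < d -> d <= Cmod z -> w <> 0.
Proof.
intros H1 H2 ->. replace (0 - z)%C with (- z)%C in H1 by ring.
rewrite Cmod_opp in H1. lra.
Qed.

Lemma cderiv_inv (z : C) : z <> 0 -> cderiv Cinv z (- / (z * z)).
Proof.
intros Hz eps He. assert (Hm : 0 < Cmod z) by now apply Cmod_gt_0.
set (m := Cmod z) in *.
(* The exact error is |w - z|^2 / (m^2 |w|), and the first bound ensures |w| >= m / 2. *)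
exists (Rmin (m / 2) (eps * m ^ 3 / 2)). split.
{ apply Rmin_pos; [lra|]. assert (0 < m ^ 3) by now apply pow_lt. nra. }
intros w Hw.
assert (H1 := Rlt_le_trans _ _ _ Hw (Rmin_l _ _)).
assert (H2 := Rlt_le_trans _ _ _ Hw (Rmin_r _ _)).
assert (Hw0 : w <> 0) by (apply Cmod_sub_lt_neq with (1 := H1); fold m; lra).
assert (Hwm : m / 2 <= Cmod w).
{ assert (T := Cmod_triangle w (- (w - z))). rewrite Cmod_opp in T.
  replace (w + - (w - z))%C with z in T by ring. fold m in T. lra. }
replace (/ w - / z - - / (z * z) * (w - z))%C
  with ((w - z) * (w - z) * / (z * z * w))%C by (field; auto).
rewrite !Cmod_mult, Cmod_inv, !Cmod_mult.
2: { intros E. apply (f_equal Cmod) in E. rewrite !Cmod_mult, Cmod_0 in E. fold m in E.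
     assert (0 < m * m * Cmod w) by (apply Rmult_lt_0_compat; nra). lra. }
fold m. set (h := Cmod (w - z)) in *. assert (Hh : 0 <= h) by apply Cmod_ge_0.
assert (Hmw : 0 < m * m * Cmod w) by (apply Rmult_lt_0_compat; nra).
assert (K : h * / (m * m * Cmod w) <= eps).
{ apply Rmult_le_reg_r with (m * m * Cmod w); [exact Hmw|].
  rewrite Rmult_assoc, Rinv_l, Rmult_1_r by lra.
  apply Rle_trans with (eps * (m * m * (m / 2))); [nra|].
  apply Rmult_le_compat_l; [lra|]. apply Rmult_le_compat_l; nra. }
nra.
Qed.

Lemma cderiv_quotient (f : C -> C) (w z l : C) : z <> w -> cderiv f z l ->
  exists l', cderiv (fun v => (f v - f w) / (v - w))%C z l'.
Proof.
intros Hzw Hf.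
assert (Hs : forall al v, cderiv (fun v => v + al)%C v 1).
{ intros al v eps He. exists 1. split; [lra|]. intros u _.
  replace (u + al - (v + al) - 1 * (u - v))%C with (RtoC 0) by ring.
  rewrite Cmod_0. generalize (Cmod_ge_0 (u - v)). nra. }
assert (H1 := cderiv_comp (fun v => v + (- f w))%C f z 1 l (Hs _ _) Hf).
assert (H2 : cderiv (fun v => / (v + (- w)))%C z (1 * (- / ((z + - w) * (z + - w))))).
{ apply (cderiv_comp Cinv (fun v => v + - w)%C).
  - apply cderiv_inv. intros E. apply Hzw. replace z with ((z + - w) + w)%C by ring. rewrite E. ring.
  - apply Hs. }
eexists. exact (cderiv_mult _ _ _ _ _ H1 H2).
Qed.

(** With l = f'(w) as its value at w, the quotient is continuous there, as [circle_int_zero] demands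
    of its exceptional point. *)
Definition diff_quotient (f : C -> C) (w l z : C) : C :=
  if excluded_middle_informative (z = w) then l else ((f z - f w) / (z - w))%C.

Lemma diff_quotient_cderiv (f : C -> C) (w l z lz : C) : z <> w -> cderiv f z lz ->
  exists l', cderiv (diff_quotient f w l) z l'.
Proof.
intros Hzw Hf. destruct (cderiv_quotient f w z lz Hzw Hf) as [l' Hl'].
exists l'. apply cderiv_ext_loc with (3 := Hl') (d := Cmod (z - w)).
- now apply Cmod_sub_pos.
- intros v Hv. unfold diff_quotient. destruct excluded_middle_informative as [->|]; auto.
  rewrite Cmod_minus_sym in Hv. lra.
Qed.

Lemma diff_quotient_ccont (f : C -> C) (w l : C) : cderiv f w l ->
  ccont (diff_quotient f w l) w.
Proof.
intros Hf eps He. destruct (Hf (eps / 2)) as [d [Hd H]]; [lra|].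
exists d; split; auto. intros v Hv. unfold diff_quotient.
destruct (excluded_middle_informative (w = w)) as [_|]; [|congruence].
destruct excluded_middle_informative as [_|Hvw].
- replace (l - l)%C with (RtoC 0) by ring. now rewrite Cmod_0.
- specialize (H v Hv). assert (Hp := Cmod_sub_pos v w Hvw).
  assert (Hne : (v - w)%C <> 0) by now apply Cmod_gt_0.
  replace ((f v - f w) / (v - w) - l)%C with ((f v - f w - l * (v - w)) / (v - w))%C by (field; auto).
  rewrite Cmod_div by auto. apply Rle_lt_trans with (eps / 2); [|lra].
  apply Rmult_le_reg_r with (Cmod (v - w)); [auto|].
  unfold Rdiv at 1. rewrite Rmult_assoc, Rinv_l by lra. lra.
Qed.

Definition holo (R0 : R) (f : C -> C) : Prop :=
  forall z, Cmod z < R0 -> exists l, cderiv f z l.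

Lemma holo_ccont (R0 : R) (f : C -> C) (z : C) : holo R0 f -> Cmod z < R0 -> ccont f z.
Proof. intros H Hz. destruct (H z Hz) as [l Hl]. now apply cderiv_ccont with l. Qed.

Lemma ccont_inv (z : C) : z <> 0 -> ccont Cinv z.
Proof. intros H. eapply cderiv_ccont, cderiv_inv, H. Qed.

Lemma pcont_inv (p : R -> C) (t : R) : p t <> 0 -> pcont p t -> pcont (fun s => / p s)%C t.
Proof. intros H Hp. apply (pcont_comp Cinv p); auto using ccont_inv. Qed.

Lemma pcont_pow (p : R -> C) (k : nat) (t : R) : pcont p t -> pcont (fun s => p s ^ k)%C t.
Proof.
intros Hp. induction k as [|k IH]; simpl; [apply pcont_const|now apply pcont_mult].
Qed.

Lemma circ_neq (r t : R) (w : C) : Cmod w < r -> (circ r t - w)%C <> 0.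
Proof.
intros Hw E. assert (H : circ r t = w).
{ replace (circ r t) with ((circ r t - w) + w)%C by ring. rewrite E. ring. }
assert (H' := f_equal Cmod H). rewrite Cmod_circ in H'; [lra|].
generalize (Cmod_ge_0 w); lra.
Qed.

Lemma circ_neq0 (r t : R) : 0 < r -> circ r t <> 0.
Proof.
intros Hr E. apply (circ_neq r t 0); [now rewrite Cmod_0|]. rewrite E. ring.
Qed.

Lemma Cpow_circ (r t : R) (k : nat) : (circ r t ^ k)%C = circ (r ^ k) (INR k * t).
Proof.
induction k as [|k IH].
- simpl. unfold circ. rewrite Rmult_0_l, cos_0, sin_0. apply injective_projections; simpl; ring.
- rewrite S_INR, Rmult_plus_distr_r, Rmult_1_l.
  replace (circ r t ^ S k)%C with (circ r t * circ r t ^ k)%C by reflexivity. rewrite IH.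
  unfold circ. rewrite cos_plus, sin_plus. apply injective_projections; simpl; ring.
Qed.

Lemma Cinv_circ (r t : R) : 0 < r -> (/ circ r t)%C = circ (/ r) (- t).
Proof.
intros Hr. assert (E : (circ r t * circ (/ r) (- t))%C = 1).
{ unfold circ. rewrite cos_neg, sin_neg. generalize (sin2_cos2 t). unfold Rsqr. intros E.
  apply injective_projections; simpl; [|field; lra].
  rewrite <- E. field. lra. }
assert (Hn := circ_neq0 r t Hr).
transitivity (/ circ r t * (circ r t * circ (/ r) (- t)))%C.
- rewrite E. ring.
- field. exact Hn.
Qed.

(** On the circle the integrand is a multiple of e^(-i (k+1) t), which has an explicit primitive of
    period 2 pi because k + 1 is not 0. *)
Lemma circle_int_inv_pow (r : R) (k : nat) : 0 < r ->
  circle_int (fun z => / z ^ S k)%C r = 0.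
Proof.
intros Hr. unfold circle_int.
set (n := INR (S k)). assert (Hn : 0 < n) by (apply lt_0_INR; lia).
set (s := / r ^ S k).
rewrite (CInt_ext _ _ _ (fun t => circ s (- (n * t)))).
2: apply two_PI_ge_0.
2: { intros t _. rewrite Cpow_circ, Cinv_circ; auto. now apply pow_lt. }
assert (H2 : sin (n * (2 * PI)) = 0 /\ cos (n * (2 * PI)) = 1).
{ assert (E1 := sin_period 0 (S k)). assert (E2 := cos_period 0 (S k)). fold n in E1, E2.
  rewrite sin_0 in E1. rewrite cos_0 in E2.
  replace (n * (2 * PI)) with (0 + 2 * n * PI) by ring. auto. }
destruct H2 as [H2 H3].
unfold CInt. apply injective_projections; apply is_RInt_unique; cbn [fst snd Re Im circ].
- replace (fst (RtoC 0)) with (minus (s * sin (n * (2 * PI)) / n) (s * sin (n * 0) / n)).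
  2: { rewrite H2, (Rmult_0_r n), sin_0. unfold minus, plus, opp; simpl. field. lra. }
  apply (is_RInt_derive (fun t => s * sin (n * t) / n)).
  + intros x _. auto_derive; [auto|]. rewrite cos_neg. field. lra.
  + intros x _. apply continuity_pt_filterlim. reg.
- replace (snd (RtoC 0)) with (minus (s * cos (n * (2 * PI)) / n) (s * cos (n * 0) / n)).
  2: { rewrite H3, (Rmult_0_r n), cos_0. unfold minus, plus, opp; simpl. field. lra. }
  apply (is_RInt_derive (fun t => s * cos (n * t) / n)).
  + intros x _. auto_derive; [auto|]. rewrite sin_neg. field. lra.
  + intros x _. apply continuity_pt_filterlim. reg.
Qed.

Fixpoint csum (a : nat -> C) (n : nat) : C :=
  match n with
  | O => 0
  | S m => (csum a m + a m)%C
  end.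

Lemma csum_ext (a b : nat -> C) (n : nat) :
  (forall k, (k < n)%nat -> a k = b k) -> csum a n = csum b n.
Proof.
induction n as [|n IH]; intros H; simpl; [reflexivity|].
rewrite IH by (intros; apply H; lia). rewrite H by lia. reflexivity.
Qed.

Lemma csum_scal (c : C) (a : nat -> C) (n : nat) :
  csum (fun k => c * a k)%C n = (c * csum a n)%C.
Proof. induction n as [|n IH]; simpl; [ring|rewrite IH; ring]. Qed.

Lemma pcont_circ_Cmod_bounded (g : C -> C) (r : R) :
  (forall t, ccont g (circ r t)) -> exists M, 0 <= M /\ forall t, 0 <= t <= 2 * PI -> Cmod (g (circ r t)) <= M.
Proof.
intros Hg.
destruct (continuity_ab_maj (fun t => Cmod (g (circ r t))) 0 (2 * PI) two_PI_ge_0) as [t0 [H1 H2]].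
- intros t _ eps He.
  destruct (pcont_comp g (circ r) t (Hg t) (pcont_circ r t) eps He) as [d [Hd H]].
  exists d; split; [exact Hd|]. intros s [_ Hs]. apply Rle_lt_trans with (2 := H s Hs).
  assert (T1 := Cmod_triangle (g (circ r s) - g (circ r t)) (g (circ r t))).
  assert (T2 := Cmod_triangle (g (circ r t) - g (circ r s)) (g (circ r s))).
  rewrite (Cmod_minus_sym (g (circ r t))) in T2.
  replace (g (circ r s) - g (circ r t) + g (circ r t))%C with (g (circ r s)) in T1 by ring.
  replace (g (circ r t) - g (circ r s) + g (circ r s))%C with (g (circ r t)) in T2 by ring.
  unfold dist; simpl; unfold Rdist. apply Rabs_le. lra.
- exists (Cmod (g (circ r t0))). split; [apply Cmod_ge_0|auto].
Qed.

(** The finite geometric sum for z / (z - w) leaves the exact remainder (w/z)^N z / (z - w), so no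
    series is exchanged with an integral. Continuity of g on the circle is enough, which lets the
    lemma serve both for g = 1 and for g = f. *)
Lemma cauchy_kernel_expansion (g : C -> C) (r M : R) (w : C) (N : nat) :
  Cmod w < r -> (forall t, ccont g (circ r t)) ->
  (forall t, 0 <= t <= 2 * PI -> Cmod (g (circ r t)) <= M) ->
  Cmod (circle_int (fun z => g z * (z / (z - w)))%C r
        - csum (fun k => w ^ k * circle_int (fun z => g z * / z ^ k)%C r)%C N)
  <= 4 * PI * (M * (Cmod w / r) ^ N * (r / (r - Cmod w))).
Proof.
intros Hw Hg HM.
assert (Hw0 := Cmod_ge_0 w). assert (Hr : 0 < r) by lra.
assert (Hpg : forall t, pcont (fun t => g (circ r t)) t)
  by (intros t; apply pcont_comp; auto using pcont_circ).
assert (Hp1 : forall k t, pcont (fun t => g (circ r t) * / circ r t ^ k)%C t).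
{ intros k t. apply pcont_mult; auto. apply (pcont_inv (fun s => circ r s ^ k)%C).
  - rewrite Cpow_circ. apply circ_neq0. now apply pow_lt.
  - apply pcont_pow, pcont_circ. }
assert (Hp2 : forall t, pcont (fun t => circ r t / (circ r t - w))%C t).
{ intros t. apply pcont_mult; [apply pcont_circ|].
  apply (pcont_inv (fun s => circ r s - w)%C); [now apply circ_neq|].
  apply pcont_plus; [apply pcont_circ|apply pcont_const]. }
assert (Hp3 : forall k t, pcont (fun t => w ^ k * (g (circ r t) * / circ r t ^ k * (circ r t / (circ r t - w))))%C t).
{ intros k t. apply pcont_mult; [apply pcont_const|]. apply pcont_mult; auto. }
assert (Hrem : forall n, (circle_int (fun z => g z * (z / (z - w)))%C r
        - csum (fun k => w ^ k * circle_int (fun z => g z * / z ^ k)%C r)%C n)%C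
   = CInt (fun t => w ^ n * (g (circ r t) * / circ r t ^ n * (circ r t / (circ r t - w))))%C 0 (2 * PI)).
{ induction n as [|n IH].
  - simpl csum. unfold circle_int.
    rewrite (CInt_ext _ _ _ (fun t => w ^ 0 * (g (circ r t) * / circ r t ^ 0 * (circ r t / (circ r t - w))))%C).
    + ring.
    + apply two_PI_ge_0.
    + intros t _. simpl. field. now apply circ_neq.
  - simpl csum.
    set (A := circle_int (fun z => g z * (z / (z - w)))%C r) in *.
    set (B := csum _ n) in *.
    unfold circle_int at 1. rewrite <- CInt_scal; [|apply two_PI_ge_0|intros t _; auto].
    set (D := CInt _ _ _). replace (A - (B + D))%C with ((A - B) - D)%C by ring.
    rewrite IH. unfold D. rewrite <- CInt_minus; [|apply two_PI_ge_0|intros t _; auto|].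
    2: { intros t _. apply pcont_mult; [apply pcont_const|auto]. }
    apply CInt_ext; [apply two_PI_ge_0|]. intros t _.
    assert (E1 := circ_neq r t w Hw). assert (E2 := circ_neq0 r t Hr).
    set (z := circ r t) in *. simpl.
    assert (E3 : (z ^ n)%C <> 0).
    { unfold z. rewrite Cpow_circ. apply circ_neq0. now apply pow_lt. }
    field. auto. }
rewrite Hrem.
apply Rle_trans with (2 * (M * (Cmod w / r) ^ N * (r / (r - Cmod w)) * (2 * PI - 0))).
2: right; ring.
apply CInt_bound; [apply two_PI_ge_0|intros t _; auto|].
intros t Ht. specialize (HM t Ht).
assert (E1 := circ_neq r t w Hw). assert (E2 := circ_neq0 r t Hr).
assert (E3 : (circ r t ^ N)%C <> 0).
{ rewrite Cpow_circ. apply circ_neq0. now apply pow_lt. }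
rewrite !Cmod_mult, Cmod_div, !Cmod_inv, !Cmod_pow, !Cmod_circ by (auto; lra).
assert (Hd : r - Cmod w <= Cmod (circ r t - w)).
{ assert (T := Cmod_triangle (circ r t - w) w).
  replace (circ r t - w + w)%C with (circ r t) in T by ring. rewrite Cmod_circ in T; lra. }
unfold Rdiv. rewrite Rpow_mult_distr, pow_inv.
assert (P1 : 0 <= Cmod w ^ N) by now apply pow_le.
assert (P2 : 0 < / r ^ N) by (apply Rinv_0_lt_compat, pow_lt; auto).
assert (P3 : / Cmod (circ r t - w) <= / (r - Cmod w)) by (apply Rinv_le_contravar; lra).
assert (P4 : 0 < / Cmod (circ r t - w)) by (apply Rinv_0_lt_compat; lra).
assert (P5 := Cmod_ge_0 (g (circ r t))).
apply Rle_trans with (Cmod w ^ N * / r ^ N * r * (Cmod (g (circ r t)) * / Cmod (circ r t - w))); [right; ring|].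
apply Rle_trans with (Cmod w ^ N * / r ^ N * r * (M * / (r - Cmod w))); [|right; ring].
apply Rmult_le_compat_l.
- apply Rmult_le_pos; [apply Rmult_le_pos|]; lra.
- apply Rmult_le_compat; lra.
Qed.

(** The exponent is [S N] because in [circle_int_cauchy_kernel] the sum must contain its term of
    index 0. *)
Lemma geometric_eventually_small (x A eps : R) : 0 <= x < 1 -> 0 < eps -> 0 <= A ->
  exists N, A * x ^ S N <= eps.
Proof.
intros Hx He HA. destruct (pow_lt_1_zero x) with (y := eps / (A + 1)) as [N HN].
- rewrite Rabs_pos_eq; lra.
- apply Rdiv_lt_0_compat; lra.
- exists N. specialize (HN (S N) (le_S _ _ (le_n N))).
  assert (0 <= x ^ S N) by (apply pow_le; lra).
  rewrite Rabs_pos_eq in HN by auto.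
  apply Rle_trans with ((A + 1) * (eps / (A + 1))); [|right; field; lra].
  apply Rmult_le_compat; lra.
Qed.

(** This is the kernel expansion for g = 1: the term k = 0 gives 2 pi, the others vanish by
    [circle_int_inv_pow], and the remainder tends to 0. *)
Lemma circle_int_cauchy_kernel (r : R) (w : C) : Cmod w < r ->
  circle_int (fun z => z / (z - w))%C r = RtoC (2 * PI).
Proof.
intros Hw. assert (Hw0 := Cmod_ge_0 w).
assert (HP := PI_RGT_0).
assert (H : Cmod (circle_int (fun z => z / (z - w))%C r - RtoC (2 * PI)) = 0).
{ apply Rle_antisym; [|apply Cmod_ge_0]. apply Rle_plus_epsilon. intros eps He.
  destruct (geometric_eventually_small (Cmod w / r) (4 * PI * (r / (r - Cmod w))) eps) as [N HN]; auto.
  { split.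
    - apply Rmult_le_pos; [auto|]. left. apply Rinv_0_lt_compat. lra.
    - apply Rmult_lt_reg_r with r; [lra|]. unfold Rdiv. rewrite Rmult_assoc, Rinv_l; lra. }
  { apply Rmult_le_pos; [lra|]. apply Rlt_le, Rdiv_lt_0_compat; lra. }
  assert (K := cauchy_kernel_expansion (fun _ => RtoC 1) r 1 w (S N) Hw).
  assert (Hc : forall t : R, ccont (fun _ => RtoC 1) (circ r t)).
  { intros t e He'. exists 1. split; [lra|]. intros v _.
    replace (1 - 1)%C with (RtoC 0) by ring. now rewrite Cmod_0. }
  specialize (K Hc).
  specialize (K ltac:(intros; cbv beta; rewrite Cmod_1; lra)).
  replace (csum _ (S N)) with (RtoC (2 * PI)) in K.
  - replace (circle_int (fun z => 1 * (z / (z - w)))%C r) with (circle_int (fun z => z / (z - w))%C r) in K.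
    + apply Rle_trans with (1 := K). rewrite Rplus_0_l.
      apply Rle_trans with (2 := HN). right. ring.
    + apply CInt_ext; [apply two_PI_ge_0|]. intros; ring.
  - clear HN K. induction N as [|N IH].
    + simpl. unfold circle_int. rewrite (CInt_ext _ _ _ (fun _ => RtoC 1)).
      * rewrite CInt_const. apply injective_projections; simpl; ring.
      * apply two_PI_ge_0.
      * intros t _. apply injective_projections; simpl; field.
    + change (RtoC (2 * PI) = csum (fun k => w ^ k * circle_int (fun z => 1 * / z ^ k) r)%C (S N)
         + w ^ S N * circle_int (fun z => 1 * / z ^ S N) r)%C.
      rewrite <- IH.
      replace (circle_int (fun z => 1 * / z ^ S N)%C r) with (RtoC 0); [ring|].
      rewrite <- (circle_int_inv_pow r N) by lra.
      apply CInt_ext; [apply two_PI_ge_0|]. intros; ring. }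
apply Cmod_eq_0 in H.
set (A := circle_int _ r) in *. replace A with ((A - RtoC (2 * PI)) + RtoC (2 * PI))%C by ring.
rewrite H. ring.
Qed.

(** The completed difference quotient at w has integral zero; splitting its numerator leaves f(w)
    times the integral of the kernel. *)
Theorem cauchy_formula (f : C -> C) (R0 r : R) (w : C) : Cmod w < r < R0 -> holo R0 f ->
  circle_int (fun z => f z * (z / (z - w)))%C r = (RtoC (2 * PI) * f w)%C.
Proof.
intros Hw Hf. assert (Hw0 := Cmod_ge_0 w).
destruct (Hf w ltac:(lra)) as [l Hl].
assert (H := circle_int_zero (diff_quotient f w l) w R0 r Hw).
specialize (H ltac:(intros z Hz; destruct (excluded_middle_informative (z = w)) as [->|Hzw];
  [now apply diff_quotient_ccont|destruct (Hf z Hz) as [lz Hlz];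
   destruct (diff_quotient_cderiv f w l z lz Hzw Hlz) as [l' Hl']; now apply cderiv_ccont with l'])).
specialize (H ltac:(intros z Hz Hzw; destruct (Hf z Hz) as [lz Hlz];
   exact (diff_quotient_cderiv f w l z lz Hzw Hlz))).
assert (Hp2 : forall t, pcont (fun t => circ r t / (circ r t - w))%C t).
{ intros t. apply pcont_mult; [apply pcont_circ|].
  apply (pcont_inv (fun s => circ r s - w)%C); [now apply circ_neq|].
  apply pcont_plus; [apply pcont_circ|apply pcont_const]. }
assert (Hpf : forall t, pcont (fun t => f (circ r t)) t).
{ intros t. apply pcont_comp; [|apply pcont_circ]. apply (holo_ccont R0); auto.
  rewrite Cmod_circ; lra. }
rewrite <- (circle_int_cauchy_kernel r w) by lra.
assert (E : circle_int (fun z => diff_quotient f w l z * z)%C r =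
  (circle_int (fun z => f z * (z / (z - w)))%C r - f w * circle_int (fun z => z / (z - w))%C r)%C).
{ unfold circle_int. rewrite <- CInt_scal, <- CInt_minus; auto using two_PI_ge_0.
  - apply CInt_ext; [apply two_PI_ge_0|]. intros t _. unfold diff_quotient.
    assert (Hn := circ_neq r t w (proj1 Hw)).
    destruct excluded_middle_informative as [E|_].
    + exfalso. apply Hn. rewrite E. ring.
    + field. exact Hn.
  - intros t _. apply pcont_mult; auto.
  - intros t _. apply pcont_mult; [apply pcont_const|auto].
  - intros t _. auto. }
rewrite H in E.
set (A := circle_int (fun z => f z * (z / (z - w)))%C r) in *.
set (B := circle_int (fun z => z / (z - w))%C r) in *.
replace A with ((A - f w * B) + f w * B)%C by ring. rewrite <- E. ring.
Qed.

(** The coefficients are integrals over the circle of radius r itself, which gives the last clause;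
    that clause later excludes zeros of f on the positive axis. *)
Theorem taylor_expansion (f : C -> C) (R0 r : R) : 0 < r < R0 -> holo R0 f ->
  exists (c : nat -> C) (M : R), 0 <= M /\
    (forall N w, Cmod w < r ->
       Cmod (f w - csum (fun k => c k * w ^ k)%C N) <= M * (Cmod w / r) ^ N / (r - Cmod w)) /\
    ((forall t, f (circ r t) = 0) -> forall k, c k = 0).
Proof.
intros Hr Hf. assert (HP := PI_RGT_0).
assert (Hg : forall t, ccont f (circ r t)).
{ intros t. apply (holo_ccont R0); auto. rewrite Cmod_circ; lra. }
destruct (pcont_circ_Cmod_bounded f r Hg) as [M [HM0 HM]].
assert (HPc : RtoC (2 * PI) <> 0) by (intros E; injection E; lra).
exists (fun k => / RtoC (2 * PI) * circle_int (fun z => f z * / z ^ k)%C r)%C, (2 * M * r).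
split; [|split].
- apply Rmult_le_pos; lra.
- intros N w Hw.
  assert (K := cauchy_kernel_expansion f r M w N Hw Hg HM).
  rewrite (cauchy_formula f R0 r w) in K; [|lra|auto].
  rewrite (csum_ext _ (fun k => / RtoC (2 * PI) * (w ^ k * circle_int (fun z => f z * / z ^ k)%C r))%C).
  2: intros k _; ring.
  rewrite csum_scal. set (S := csum _ N) in *.
  replace (f w - / RtoC (2 * PI) * S)%C with (/ RtoC (2 * PI) * (RtoC (2 * PI) * f w - S))%C by (field; auto).
  rewrite Cmod_mult, Cmod_inv, Cmod_R, Rabs_pos_eq by (auto; lra).
  apply Rmult_le_reg_l with (2 * PI); [lra|].
  rewrite <- Rmult_assoc, Rinv_r, Rmult_1_l by lra.
  apply Rle_trans with (1 := K). right. field. lra.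
- intros H0 k. unfold circle_int. rewrite (CInt_ext _ _ _ (fun _ => RtoC 0)).
  + rewrite CInt_const. ring.
  + apply two_PI_ge_0.
  + intros t _. rewrite H0. ring.
Qed.

(** * Restriction to the real axis *)

(** The bound makes u the sum of a power series near 0, and the real theory of power series then
    gives all its derivatives at 0 at once. *)
Lemma Derive_n_of_geometric_approx (u : R -> R) (a : nat -> R) (r M : R) : 0 < r ->
  (forall n x, Rabs x < r ->
     Rabs (u x - sum_n (fun k => a k * x ^ k) n) <= M * (Rabs x / r) ^ S n / (r - Rabs x)) ->
  forall k, Derive_n u k 0 = a k * INR (Factorial.fact k) /\ ex_derive_n u k 0.
Proof.
intros Hr H.
assert (Hs : forall x, Rabs x < r -> is_series (fun k => a k * x ^ k) (u x)).
{ intros x Hx. assert (Hx0 := Rabs_pos x).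
  set (q := Rabs x / r).
  assert (Hq : 0 <= q < 1).
  { unfold q. split.
    - apply Rmult_le_pos; [auto|]. left. now apply Rinv_0_lt_compat.
    - apply Rmult_lt_reg_r with r; [auto|]. unfold Rdiv. rewrite Rmult_assoc, Rinv_l; lra. }
  assert (Hg : is_lim_seq (fun n => M / (r - Rabs x) * q * q ^ n) 0).
  { replace (Finite 0) with (Rbar_mult (M / (r - Rabs x) * q) 0)
      by (simpl; now rewrite Rmult_0_r).
    apply is_lim_seq_scal_l. apply is_lim_seq_geom. rewrite Rabs_pos_eq; lra. }
  change (is_lim_seq (sum_n (fun k => a k * x ^ k)) (u x)).
  apply is_lim_seq_le_le with
    (u := fun n => u x - M / (r - Rabs x) * q * q ^ n)
    (w := fun n => u x + M / (r - Rabs x) * q * q ^ n).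
  - intros n. specialize (H n x Hx). apply Rabs_le_between in H. fold q in H. simpl in H.
    unfold Rdiv in *. lra.
  - replace (Finite (u x)) with (Finite (u x - 0)) by (f_equal; ring).
    apply is_lim_seq_minus'; [apply is_lim_seq_const|exact Hg].
  - replace (Finite (u x)) with (Finite (u x + 0)) by (f_equal; ring).
    apply is_lim_seq_plus'; [apply is_lim_seq_const|exact Hg]. }
(* The series converges at r / 2, so its terms tend to 0 there; beyond the radius of convergence
   they would not. *)
assert (HCV : Rbar_lt 0 (CV_radius a)).
{ apply Rbar_lt_le_trans with (Finite (r / 2)); [simpl; lra|].
  apply Rbar_not_lt_le. intros HC.
  apply (CV_disk_outside a (r / 2)).
  - rewrite Rabs_pos_eq by lra. exact HC.
  - apply ex_series_lim_0. exists (u (r / 2)). apply Hs. rewrite Rabs_pos_eq; lra. }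
assert (Hloc : locally 0 (fun x => PSeries a x = u x)).
{ exists (mkposreal r Hr). intros x Hx. apply is_pseries_unique, is_pseries_R, Hs.
  rewrite <- (Rminus_0_r x). exact Hx. }
intros k. split.
- rewrite <- Derive_n_coef by exact HCV. symmetry. now apply Derive_n_ext_loc.
- apply ex_derive_n_ext_loc with (1 := Hloc). apply ex_derive_n_PSeries.
  now rewrite Rabs_R0.
Qed.

Lemma Cpow_RtoC (x : R) (k : nat) : (RtoC x ^ k)%C = RtoC (x ^ k).
Proof.
induction k as [|k IH]; [reflexivity|].
simpl. rewrite IH. apply injective_projections; simpl; ring.
Qed.

(** [csum] stops before its bound and [sum_n] includes it, hence [S n] on one side. *)
Lemma Re_Im_csum (c : nat -> C) (x : R) (n : nat) :
  Re (csum (fun k => c k * RtoC x ^ k)%C (S n)) = sum_n (fun k => Re (c k) * x ^ k) n /\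
  Im (csum (fun k => c k * RtoC x ^ k)%C (S n)) = sum_n (fun k => Im (c k) * x ^ k) n.
Proof.
induction n as [|n [I1 I2]].
- rewrite !sum_O. simpl. unfold Re, Im; split; ring.
- rewrite !sum_Sn, <- I1, <- I2.
  change (csum (fun k => c k * RtoC x ^ k)%C (S (S n)))
    with (csum (fun k => c k * RtoC x ^ k)%C (S n) + c (S n) * RtoC x ^ S n)%C.
  rewrite Cpow_RtoC. set (S := csum _ _). unfold plus, Re, Im; simpl. split; ring.
Qed.

Definition re_trace (f : C -> C) (x : R) : R := Re (f (RtoC x)).
Definition im_trace (f : C -> C) (x : R) : R := Im (f (RtoC x)).

Lemma holo_translate (R0 : R) (f : C -> C) (x0 : R) : holo R0 f ->
  holo (R0 - Rabs x0) (fun z => f (z + RtoC x0)%C).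
Proof.
intros Hf z Hz. destruct (Hf (z + RtoC x0)%C) as [l Hl].
{ apply Rle_lt_trans with (1 := Cmod_triangle _ _). rewrite Cmod_R. lra. }
exists l. intros eps He. destruct (Hl eps He) as [d [Hd H]]. exists d. split; auto.
intros w Hw. specialize (H (w + RtoC x0)%C).
replace (w + x0 - (z + x0))%C with (w - z)%C in H by ring. auto.
Qed.

(** The same coefficients control f in a complex neighbourhood of x0 and give the real derivatives
    of both traces; the extremality tests need the two together. *)
Lemma local_taylor (f : C -> C) (R0 x0 : R) : Rabs x0 < R0 -> holo R0 f ->
  exists (c : nat -> C) (r M : R), 0 < r /\ 0 <= M /\
   (forall N h, Cmod h < r -> Cmod (f (RtoC x0 + h)%C - csum (fun k => c k * h ^ k)%C N) <= M * Cmod h ^ N / r ^ N) /\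
   (forall k, Derive_n (re_trace f) k x0 = Re (c k) * INR (Factorial.fact k) /\
              ex_derive_n (re_trace f) k x0) /\
   (forall k, Derive_n (im_trace f) k x0 = Im (c k) * INR (Factorial.fact k) /\
              ex_derive_n (im_trace f) k x0).
Proof.
intros Hx0 Hf. set (r := (R0 - Rabs x0) / 2).
assert (Hr : 0 < r) by (unfold r; lra).
destruct (taylor_expansion _ (R0 - Rabs x0) r ltac:(unfold r; lra) (holo_translate R0 f x0 Hf)) as [c [M [HM [H _]]]].
assert (Htr : forall (u : R -> R) k a, Derive_n (fun x => u (x + x0)) k 0 = a /\
   ex_derive_n (fun x => u (x + x0)) k 0 -> Derive_n u k x0 = a /\ ex_derive_n u k x0).
{ intros u k a [H1 H2]. split.
  - rewrite Derive_n_comp_trans, Rplus_0_l in H1. exact H1.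
    rewrite <- (Rplus_opp_r x0) in H2.
    apply (ex_derive_n_ext (fun x => u (x + - x0 + x0)) u).
    + intros t. f_equal. ring.
    + exact (ex_derive_n_comp_trans (fun y => u (y + x0)) k x0 (- x0) H2). }
assert (Hreal : forall n (x : R), Rabs x < r ->
   Cmod (f (RtoC (x + x0)) - csum (fun k => c k * RtoC x ^ k)%C (S n)) <= M * (Rabs x / r) ^ S n / (r - Rabs x)).
{ intros n x Hx. specialize (H (S n) (RtoC x)). rewrite Cmod_R in H.
  rewrite RtoC_plus. apply H. exact Hx. }
assert (Hx0k : forall k, Derive_n (re_trace f) k x0 = Re (c k) * INR (Factorial.fact k) /\
              ex_derive_n (re_trace f) k x0).
{ intros k. apply Htr.
  apply (Derive_n_of_geometric_approx (fun x => re_trace f (x + x0)) (fun k => Re (c k)) r M Hr).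
  intros n x Hx. rewrite <- (proj1 (Re_Im_csum c x n)).
  apply Rle_trans with (2 := Hreal n x Hx). exact (Re_le_Cmod (f (RtoC (x + x0)) - _)). }
assert (Hx0k' : forall k, Derive_n (im_trace f) k x0 = Im (c k) * INR (Factorial.fact k) /\
              ex_derive_n (im_trace f) k x0).
{ intros k. apply Htr.
  apply (Derive_n_of_geometric_approx (fun x => im_trace f (x + x0)) (fun k => Im (c k)) r M Hr).
  intros n x Hx. rewrite <- (proj2 (Re_Im_csum c x n)).
  apply Rle_trans with (2 := Hreal n x Hx). exact (Im_le_Cmod (f (RtoC (x + x0)) - _)). }
(* On half the radius 1 / (r - |h|) is at most 2 / r, so the remainder becomes a pure power of
   |h|. *)
exists c, (r / 2), (2 * M / r).
split; [lra|]. split; [|split; [|split; [exact Hx0k|exact Hx0k']]].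
- apply Rmult_le_pos; [lra|]. left. now apply Rinv_0_lt_compat.
- intros N h Hh. rewrite Cplus_comm.
  apply Rle_trans with (1 := H N h ltac:(lra)).
  assert (Hh0 := Cmod_ge_0 h).
  assert (P : 0 <= Cmod h ^ N) by now apply pow_le.
  apply Rle_trans with (M * (Cmod h / r) ^ N * (2 / r)).
  + unfold Rdiv at 1. apply Rmult_le_compat_l.
    * apply Rmult_le_pos; auto. apply pow_le, Rmult_le_pos; auto. left. now apply Rinv_0_lt_compat.
    * replace (2 / r) with (/ (r / 2)) by (field; lra). apply Rinv_le_contravar; lra.
  + assert (Q : / r ^ N <= / (r / 2) ^ N).
    { apply Rinv_le_contravar; [apply pow_lt; lra|]. apply pow_incr; lra. }
    unfold Rdiv in Q |- *. rewrite Rpow_mult_distr, pow_inv.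
    replace (M * (Cmod h ^ N * / r ^ N) * (2 * / r))
      with (2 * M * / r * Cmod h ^ N * / r ^ N) by ring.
    apply Rmult_le_compat_l; auto.
    apply Rmult_le_pos; auto. apply Rmult_le_pos; [lra|]. left. now apply Rinv_0_lt_compat.
Qed.

Lemma Lim_difference_quotient (q U : R -> R) (x d : R) : 0 < d -> ex_derive U x ->
  (forall y, Rabs (y - x) < d -> y <> x -> q y = (U y - U x) / (y - x)) ->
  real (Lim q x) = Derive U x.
Proof.
intros Hd HU Hq. rewrite (is_lim_unique q x (Derive U x)); [reflexivity|].
apply is_lim_spec. intros eps.
destruct (proj1 (is_derive_Reals _ _ _) (Derive_correct _ _ HU) eps (cond_pos eps)) as [d' Hd'].
exists (mkposreal _ (Rmin_pos _ _ Hd (cond_pos d'))). intros y Hy Hyx.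
assert (Hy1 := Rlt_le_trans _ _ _ Hy (Rmin_l _ _)).
assert (Hy2 := Rlt_le_trans _ _ _ Hy (Rmin_r _ _)).
rewrite Hq; auto. specialize (Hd' (y - x) ltac:(lra) Hy2).
rewrite Rplus_minus in Hd'. exact Hd'.
Qed.

(* [C_lim], hence [C_derive], only looks at its argument along the horizontal line through the point. *)
Lemma C_derive_n_real_axis (f : C -> C) (R0 : R) : holo R0 f ->
  forall k x, Rabs x < R0 ->
    C_derive_n f k (RtoC x) = (Derive_n (re_trace f) k x, Derive_n (im_trace f) k x).
Proof.
intros Hf. induction k as [|k IH]; intros x Hx.
- simpl. unfold re_trace, im_trace. now destruct (f (RtoC x)).
- destruct (local_taylor f R0 x Hx Hf) as (c & r & M & _ & _ & _ & Hre & Him).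
  assert (Hd : 0 < R0 - Rabs x) by lra.
  simpl C_derive_n. unfold C_derive, C_lim.
  assert (Hq : forall y, Rabs (y - x) < R0 - Rabs x -> y <> x ->
    ((C_derive_n f k (y, 0) - C_derive_n f k (RtoC x)) / ((y, 0) - RtoC x))%C
    = ((Derive_n (re_trace f) k y - Derive_n (re_trace f) k x) / (y - x),
       (Derive_n (im_trace f) k y - Derive_n (im_trace f) k x) / (y - x))).
  { intros y Hy Hyx. change (y, 0) with (RtoC y). rewrite !IH; auto.
    2: { replace y with ((y - x) + x) by ring. apply Rle_lt_trans with (1 := Rabs_triang _ _). lra. }
    rewrite <- RtoC_minus. unfold Cdiv. rewrite <- RtoC_inv by lra.
    apply injective_projections; simpl; field; lra. }
  f_equal.
  + apply Lim_difference_quotient with (R0 - Rabs x); auto; [exact (proj2 (Hre (S k)))|].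
    intros y Hy Hyx. exact (f_equal fst (Hq y Hy Hyx)).
  + apply Lim_difference_quotient with (R0 - Rabs x); auto; [exact (proj2 (Him (S k)))|].
    intros y Hy Hyx. exact (f_equal snd (Hq y Hy Hyx)).
Qed.

(** * Extremality on circles *)

(** Letting t tend to 0. All comparisons of leading coefficients below are made through this lemma
    instead of through limits. *)
Lemma le_0_of_le_linear (s K d : R) : 0 < d ->
  (forall t, 0 < t < d -> s <= K * t) -> s <= 0.
Proof.
intros Hd H. apply Rnot_lt_le. intros Hs.
set (K' := Rabs K + 1). assert (HK : 0 < K') by (unfold K'; generalize (Rabs_pos K); lra).
set (t := Rmin (d / 2) (s / (2 * K'))).
assert (Ht : 0 < t) by (apply Rmin_pos; [lra|apply Rdiv_lt_0_compat; lra]).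
assert (Ht1 : t <= d / 2) by apply Rmin_l.
assert (Ht2 : t <= s / (2 * K')) by apply Rmin_r.
specialize (H t ltac:(lra)).
assert (K * t <= K' * t).
{ apply Rmult_le_compat_r; [lra|]. unfold K'. generalize (Rle_abs K). lra. }
assert (K' * t <= K' * (s / (2 * K'))) by (apply Rmult_le_compat_l; lra).
replace (K' * (s / (2 * K'))) with (s / 2) in H1 by (field; lra). lra.
Qed.

Lemma nonneg_derivative_le (F F' : R -> R) (a b : R) :
  (forall x, a < x < b -> is_derive F x (F' x)) ->
  (forall x, a < x < b -> 0 <= F' x) ->
  forall x y, a < x -> x <= y -> y < b -> F x <= F y.
Proof.
intros HF HF' x y Hx [Hxy|<-] Hy; [|lra].
destruct (MVT_cor2 F F' x y Hxy) as [c [Hc1 Hc2]].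
- intros c Hc. apply is_derive_Reals, HF. lra.
- specialize (HF' c ltac:(lra)). nra.
Qed.

Lemma zero_derivative_eq (F : R -> R) (a b : R) :
  (forall x, a < x < b -> is_derive F x 0) ->
  forall x y, a < x < b -> a < y < b -> F x = F y.
Proof.
intros HF.
assert (H : forall x y, a < x -> x <= y -> y < b -> F x = F y).
{ intros x y Hx Hxy Hy. apply Rle_antisym.
  - apply (nonneg_derivative_le F (fun _ => 0) a b); auto; intros; lra.
  - assert (- F x <= - F y); [|lra].
    apply (nonneg_derivative_le (fun x => - F x) (fun _ => 0) a b); auto; try (intros; lra).
    intros z Hz. replace 0 with (opp 0) by (unfold opp; simpl; ring).
    apply (is_derive_opp F z 0). auto. }
intros x y Hx Hy. destruct (Rle_dec x y); [apply H; lra|symmetry; apply H; lra].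
Qed.

Lemma zero_coefficients_zero (c : nat -> C) (r M : R) (w fw : C) : Cmod w < r -> 0 <= M ->
  (forall N, Cmod (fw - csum (fun k => c k * w ^ k)%C N) <= M * (Cmod w / r) ^ N / (r - Cmod w)) ->
  (forall k, c k = 0) -> fw = 0.
Proof.
intros Hw HM H Hc. assert (Hw0 := Cmod_ge_0 w). apply Cmod_eq_0.
apply Rle_antisym; [|apply Cmod_ge_0]. apply Rle_plus_epsilon. intros eps He.
destruct (geometric_eventually_small (Cmod w / r) (M / (r - Cmod w)) eps) as [N HN]; auto.
{ split.
  - apply Rmult_le_pos; [auto|]. left. apply Rinv_0_lt_compat. lra.
  - apply Rmult_lt_reg_r with r; [lra|]. unfold Rdiv. rewrite Rmult_assoc, Rinv_l; lra. }
{ apply Rmult_le_pos; [lra|]. left. apply Rinv_0_lt_compat. lra. }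
specialize (H (S N)).
assert (E : csum (fun k => c k * w ^ k)%C (S N) = 0).
{ generalize (S N). induction n as [|n IH]; simpl; [reflexivity|].
  rewrite IH, Hc. ring. }
rewrite E in H. replace (fw - 0)%C with fw in H by ring.
apply Rle_trans with (1 := H). rewrite Rplus_0_l. apply Rle_trans with (2 := HN).
right. unfold Rdiv. ring.
Qed.

(** The zeros accumulate at the centre of the disk, so one Taylor expansion at 0 with radius beyond
    |w| is enough and no continuation along a chain of disks occurs. *)
Theorem identity_theorem (f : C -> C) (R0 d : R) : holo R0 f -> 0 < d ->
  (forall x, 0 < x < d -> f (RtoC x) = 0) -> forall w, Cmod w < R0 -> f w = 0.
Proof.
intros Hf Hd H0 w Hw. assert (Hw0 := Cmod_ge_0 w).
set (r := (R0 + Cmod w) / 2). assert (Hr : Cmod w < r < R0) by (unfold r; lra).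
destruct (taylor_expansion f R0 r ltac:(lra) Hf) as [c [M [HM [H _]]]].
apply (zero_coefficients_zero c r M w); auto; [lra|intros N; apply H; lra|].
(* If all earlier coefficients vanish, then c_k x^k = O(x^(k+1)) for small x > 0, which forces c_k =
   0. *)
intros k. induction k as [k IH] using (well_founded_induction lt_wf).
apply Cmod_eq_0. apply Rle_antisym; [|apply Cmod_ge_0].
assert (Hr0 : 0 < r) by lra.
apply (le_0_of_le_linear _ (M * (/ r ^ S k * (2 / r))) (Rmin d (r / 2))).
{ apply Rmin_pos; lra. }
intros x Hx. generalize (Rmin_l d (r / 2)) (Rmin_r d (r / 2)). intros.
specialize (H (S k) (RtoC x)). rewrite Cmod_R, Rabs_pos_eq in H by lra. specialize (H ltac:(lra)).
rewrite H0 in H by lra.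
replace (csum (fun k => c k * RtoC x ^ k)%C (S k)) with (c k * RtoC x ^ k)%C in H.
2: { simpl csum. replace (csum _ k) with (RtoC 0); [ring|].
     symmetry. assert (E : forall m, (m <= k)%nat -> csum (fun k => c k * RtoC x ^ k)%C m = 0).
     { induction m as [|m IHm]; intros Hm; [reflexivity|]. simpl. rewrite IHm, IH by lia. ring. }
     apply E. lia. }
replace (0 - c k * RtoC x ^ k)%C with (- (c k * RtoC x ^ k))%C in H by ring.
rewrite Cmod_opp, Cmod_mult, Cmod_pow, Cmod_R, Rabs_pos_eq in H by lra.
assert (Hxk : 0 < x ^ k) by (apply pow_lt; lra).
apply Rmult_le_reg_r with (x ^ k); [auto|].
apply Rle_trans with (1 := H). unfold Rdiv. rewrite Rpow_mult_distr, pow_inv.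
assert (Hrk : 0 < / r ^ S k) by (apply Rinv_0_lt_compat, pow_lt; lra).
replace (M * (/ r ^ S k * (2 * / r)) * x * x ^ k) with (M * (x ^ S k * / r ^ S k) * (2 * / r)) by (simpl; ring).
apply Rmult_le_compat_l.
- apply Rmult_le_pos; auto. apply Rmult_le_pos; [apply pow_le|]; lra.
- replace (2 * / r) with (/ (r / 2)) by (field; lra). apply Rinv_le_contravar; lra.
Qed.

(** The point x + h is x (1 + it) / (1 - it), the Cayley transform of t scaled to radius x; its
    coordinates are rational in t. *)
Lemma cayley_circle_point (x t : R) : 0 <= x -> exists h : C,
  Cmod (RtoC x + h) = x /\ Cmod h <= 2 * x * Rabs t /\ (h * (1, - t)%R)%C = (0, 2 * x * t).
Proof.
intros Hx.
assert (Ht : 0 < 1 + t ^ 2) by (generalize (pow2_ge_0 t); lra).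
exists (- 2 * x * t ^ 2 / (1 + t ^ 2), 2 * x * t / (1 + t ^ 2)).
split; [|split].
- transitivity (sqrt (x * x)); [|now apply sqrt_square].
  unfold Cmod. f_equal. simpl. field. simpl in Ht; lra.
- rewrite <- (Rabs_pos_eq (2 * x * Rabs t)).
  2: { apply Rmult_le_pos; [lra|apply Rabs_pos]. }
  rewrite <- (Rabs_pos_eq (Cmod _)) by apply Cmod_ge_0.
  apply Rsqr_le_abs_0. rewrite !Rsqr_pow2, Cmod2_alt. unfold Re, Im, fst, snd.
  rewrite Rpow_mult_distr, pow2_abs.
  apply Rle_trans with ((2 * x) ^ 2 * t ^ 2 * / (1 + t ^ 2)); [right; field; lra|].
  rewrite <- (Rmult_1_r ((2 * x) ^ 2 * t ^ 2)) at 2. apply Rmult_le_compat_l.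
  + apply Rmult_le_pos; apply pow2_ge_0.
  + rewrite <- Rinv_1. apply Rinv_le_contravar; [lra|]. generalize (pow2_ge_0 t); lra.
- apply injective_projections; simpl; field; simpl in Ht; lra.
Qed.

Lemma Cmod2_pair (x y : R) : Cmod (x, y) ^ 2 = x ^ 2 + y ^ 2.
Proof. exact (Cmod2_alt (x, y)). Qed.

(* The circle point x + h with (1 - it) h = 2ixt turns the inequality |f(x + h)| <= |f(x)| into a polynomial one in t. *)
Lemma first_order_condition (f : C -> C) (x a b p q r M : R) : 0 < x -> 0 < r -> 0 <= M ->
  (forall h, Cmod h < r -> Cmod (f (RtoC x + h)%C - ((a, b) + (p, q) * h)) <= M * Cmod h ^ 2) ->
  f (RtoC x) = (a, b) ->
  (forall z, Cmod z = x -> Cmod (f z) <= Cmod (f (RtoC x))) ->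
  b * p - a * q = 0.
Proof.
intros Hx Hr HM Hf Hfx Hmax.
set (m := Cmod (a, b)). assert (Hm : 0 <= m) by apply Cmod_ge_0.
(* For t^2 <= 1 and k = M x^2, this bounds what (m + 4 k t^2)^2 (1 + t^2) adds to m^2, per unit of
   t^2. *)
set (K := m ^ 2 + 16 * m * (M * x ^ 2) + 32 * (M * x ^ 2) ^ 2).
assert (Key : forall t, Rabs t < Rmin 1 (r / (2 * x)) -> 4 * x * (b * p - a * q) * t <= K * t ^ 2).
{ intros t Ht.
  assert (Ht1 := Rlt_le_trans _ _ _ Ht (Rmin_l _ _)).
  assert (Ht2 := Rlt_le_trans _ _ _ Ht (Rmin_r _ _)).
  destruct (cayley_circle_point x t) as [h [H1 [H2 H3]]]; [lra|].
  assert (Hhr : Cmod h < r).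
  { apply Rle_lt_trans with (1 := H2). apply Rmult_lt_compat_l with (r := 2 * x) in Ht2; [|lra].
    replace (2 * x * (r / (2 * x))) with r in Ht2 by (field; lra). exact Ht2. }
  specialize (Hf h Hhr). specialize (Hmax _ H1). rewrite Hfx in Hmax. fold m in Hmax.
  assert (T : Cmod ((a, b) + (p, q) * h) <= m + 4 * (M * x ^ 2) * t ^ 2).
  { replace ((a, b) + (p, q) * h)%C with (f (RtoC x + h) + - (f (RtoC x + h) - ((a, b) + (p, q) * h)))%C by ring.
    apply Rle_trans with (1 := Cmod_triangle _ _). rewrite Cmod_opp.
    assert (Cmod h ^ 2 <= (2 * x * Rabs t) ^ 2) by (apply pow_incr; split; [apply Cmod_ge_0|auto]).
    rewrite Rpow_mult_distr, pow2_abs in H.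
    assert (M * Cmod h ^ 2 <= M * ((2 * x) ^ 2 * t ^ 2)) by (apply Rmult_le_compat_l; auto).
    lra. }
  assert (T2 : Cmod (((a, b) + (p, q) * h) * (1, - t)%R) ^ 2 <= (m + 4 * (M * x ^ 2) * t ^ 2) ^ 2 * (1 + t ^ 2)).
  { rewrite Cmod_mult, Rpow_mult_distr, (Cmod2_pair 1).
    replace (1 ^ 2 + (- t) ^ 2) with (1 + t ^ 2) by ring.
    apply Rmult_le_compat_r; [generalize (pow2_ge_0 t); lra|].
    apply pow_incr. split; [apply Cmod_ge_0|exact T]. }
  replace (((a, b) + (p, q) * h) * (1, - t)%R)%C with ((a, b) * (1, - t)%R + (p, q) * (h * (1, - t)%R))%C in T2 by ring.
  rewrite H3 in T2.
  replace ((a, b) * (1, - t)%R + (p, q) * (0, 2 * x * t)%R)%C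
    with (a + t * b - 2 * x * t * q, b - t * a + 2 * x * t * p) in T2
    by (apply injective_projections; simpl; ring).
  rewrite Cmod2_pair in T2.
  assert (Em : m ^ 2 = a ^ 2 + b ^ 2) by apply Cmod2_pair.
  set (k := M * x ^ 2) in *. assert (Hk : 0 <= k) by (unfold k; apply Rmult_le_pos; [auto|apply pow2_ge_0]).
  set (s := t ^ 2) in *. assert (Hs : 0 <= s <= 1).
  { unfold s. split; [apply pow2_ge_0|]. rewrite <- pow2_abs. generalize (Rabs_pos t). intros. nra. }
  assert (T3 : (a + t * b - 2 * x * t * q) ^ 2 + (b - t * a + 2 * x * t * p) ^ 2
     >= m ^ 2 + 4 * x * (b * p - a * q) * t).
  { rewrite Em. generalize (pow2_ge_0 (t * b - 2 * x * t * q)) (pow2_ge_0 (- t * a + 2 * x * t * p)). lra. }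
  assert (T4 : (m + 4 * k * s) ^ 2 * (1 + s) <= m ^ 2 + K * s).
  { unfold K. fold k.
    assert (0 <= m * k) by now apply Rmult_le_pos. assert (0 <= k ^ 2) by apply pow2_ge_0.
    assert (s ^ 2 <= s) by nra. assert (s ^ 3 <= s) by nra.
    assert (m * k * s ^ 2 <= m * k * s) by (apply Rmult_le_compat_l; auto).
    assert (k ^ 2 * s ^ 2 <= k ^ 2 * s) by (apply Rmult_le_compat_l; auto).
    assert (k ^ 2 * s ^ 3 <= k ^ 2 * s) by (apply Rmult_le_compat_l; auto).
    lra. }
  lra. }
set (W := b * p - a * q) in *.
assert (Hd : 0 < Rmin 1 (r / (2 * x))) by (apply Rmin_pos; [lra|apply Rdiv_lt_0_compat; lra]).
(* The inequality [Key] holds for both signs of t, so the coefficient of its linear term is both <=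
   0 and >= 0. *)
assert (H1 : 4 * x * W <= 0).
{ apply (le_0_of_le_linear _ K _ Hd). intros t Ht.
  specialize (Key t). rewrite Rabs_pos_eq in Key by lra. specialize (Key (proj2 Ht)).
  apply Rmult_le_reg_r with t; lra. }
assert (H2 : - (4 * x * W) <= 0).
{ apply (le_0_of_le_linear _ K _ Hd). intros t Ht.
  specialize (Key (- t)). rewrite Rabs_Ropp, Rabs_pos_eq in Key by lra. specialize (Key (proj2 Ht)).
  apply Rmult_le_reg_r with t; lra. }
assert (4 * x * W = 0) by lra. apply Rmult_integral in H. destruct H; [lra|auto].
Qed.

(** For a > 0, dividing by x a^2 turns the conclusion into (x f' / f)' >= 0 at x. Because a, p and q
    are real, the terms of odd degree in t are purely imaginary after multiplication by (1 - it)^2,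
    so the coefficient of t^2 in the squared modulus decides. *)
Lemma second_order_condition (f : C -> C) (x a p q r M : R) : 0 < x -> 0 < r -> 0 <= M -> 0 <= a ->
  (forall h, Cmod h < r -> Cmod (f (RtoC x + h)%C - (RtoC a + RtoC p * h + RtoC (q / 2) * h ^ 2)) <= M * Cmod h ^ 3) ->
  f (RtoC x) = RtoC a ->
  (forall z, Cmod z = x -> Cmod (f z) <= Cmod (f (RtoC x))) ->
  (x * p) ^ 2 <= a * (x * p + x ^ 2 * q).
Proof.
intros Hx Hr HM Ha Hf Hfx Hmax.
set (k := 8 * (M * x ^ 3)).
assert (Hk : 0 <= k) by (unfold k; apply Rmult_le_pos; [lra|]; apply Rmult_le_pos; [auto|apply pow_le; lra]).
set (D := x * p). set (E := x ^ 2 * q).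
(* This is the coefficient of t^2 in the squared modulus of (1 - it)^2 times the quadratic
   expansion, minus the 2 a^2 coming from a^2 (1 + t^2)^2. *)
assert (Key : 4 * D ^ 2 - 4 * a * D - 4 * a * E <= 0).
(* K collects what is of order t^3: a^2 t^4 <= a^2 t^3, and the cubic error multiplied by (1 +
   t^2)^2 <= 4. *)
{ set (K := a ^ 2 + 4 * (2 * a * k + k ^ 2)).
  apply (le_0_of_le_linear _ K (Rmin 1 (r / (2 * x)))).
  { apply Rmin_pos; [lra|apply Rdiv_lt_0_compat; lra]. }
  intros t [Ht0 Ht].
  assert (Ht1 := Rlt_le_trans _ _ _ Ht (Rmin_l _ _)).
  assert (Ht2 := Rlt_le_trans _ _ _ Ht (Rmin_r _ _)).
  destruct (cayley_circle_point x t) as [h [H1 [H2 H3]]]; [lra|].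
  rewrite (Rabs_pos_eq t) in H2 by lra.
  assert (Hhr : Cmod h < r).
  { apply Rle_lt_trans with (1 := H2). apply Rmult_lt_compat_l with (r := 2 * x) in Ht2; [|lra].
    replace (2 * x * (r / (2 * x))) with r in Ht2 by (field; lra). exact Ht2. }
  specialize (Hf h Hhr). specialize (Hmax _ H1). rewrite Hfx, Cmod_R, Rabs_pos_eq in Hmax by lra.
  set (P := (RtoC a + RtoC p * h + RtoC (q / 2) * h ^ 2)%C) in *.
  assert (T : Cmod P <= a + k * t ^ 3).
  { replace P with (f (RtoC x + h) + - (f (RtoC x + h) - P))%C by ring.
    apply Rle_trans with (1 := Cmod_triangle _ _). rewrite Cmod_opp.
    assert (Cmod h ^ 3 <= (2 * x * t) ^ 3) by (apply pow_incr; split; [apply Cmod_ge_0|auto]).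
    assert (M * Cmod h ^ 3 <= M * (2 * x * t) ^ 3) by (apply Rmult_le_compat_l; auto).
    unfold k. lra. }
  assert (T2 : Cmod (P * ((1, - t)%R * (1, - t)%R)) ^ 2 <= (a + k * t ^ 3) ^ 2 * (1 + t ^ 2) ^ 2).
  { rewrite 2!Cmod_mult, Rpow_mult_distr, Rpow_mult_distr, (Cmod2_pair 1).
    replace ((1 ^ 2 + (- t) ^ 2) * (1 ^ 2 + (- t) ^ 2)) with ((1 + t ^ 2) ^ 2) by ring.
    apply Rmult_le_compat_r; [apply pow2_ge_0|].
    apply pow_incr. split; [apply Cmod_ge_0|exact T]. }
  replace (P * ((1, - t)%R * (1, - t)%R))%C
    with (RtoC a * ((1, - t)%R * (1, - t)%R) + RtoC p * (h * (1, - t)%R) * (1, - t)%R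
          + RtoC (q / 2) * ((h * (1, - t)%R) * (h * (1, - t)%R)))%C in T2
    by (unfold P; simpl; ring).
  rewrite H3 in T2.
  replace (RtoC a * ((1, - t)%R * (1, - t)%R) + RtoC p * (0, (2 * x * t)%R) * (1, - t)%R
          + RtoC (q / 2) * ((0, (2 * x * t)%R) * (0, (2 * x * t)%R)))%C
    with (a + t ^ 2 * (- a + 2 * D - 2 * E), 2 * t * (D - a)) in T2
    by (unfold D, E; apply injective_projections; simpl; field).
  rewrite Cmod2_pair in T2.
  assert (T3 : (a + t ^ 2 * (- a + 2 * D - 2 * E)) ^ 2 + (2 * t * (D - a)) ^ 2
     >= a ^ 2 + t ^ 2 * (2 * a * (- a + 2 * D - 2 * E) + 4 * (D - a) ^ 2)).
  { generalize (pow2_ge_0 (t ^ 2 * (- a + 2 * D - 2 * E))). lra. }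
  assert (T4 : (a + k * t ^ 3) ^ 2 * (1 + t ^ 2) ^ 2 <= a ^ 2 + t ^ 2 * (2 * a ^ 2) + K * t * t ^ 2).
  { assert (S3 : 0 <= t ^ 3 <= 1).
    { split; [apply pow_le; lra|]. rewrite <- (pow1 3). apply pow_incr; lra. }
    assert (S1 : (1 + t ^ 2) ^ 2 <= 4).
    { replace 4 with (2 ^ 2) by ring. apply pow_incr. split; nra. }
    assert (S2 : (a + k * t ^ 3) ^ 2 <= a ^ 2 + (2 * a * k + k ^ 2) * t ^ 3).
    { assert (k ^ 2 * (t ^ 3 * t ^ 3) <= k ^ 2 * t ^ 3) by (apply Rmult_le_compat_l; [apply pow2_ge_0|nra]).
      lra. }
    assert (S4 : 0 <= (2 * a * k + k ^ 2) * t ^ 3).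
    { apply Rmult_le_pos; [|lra]. assert (0 <= a * k) by now apply Rmult_le_pos. generalize (pow2_ge_0 k). lra. }
    assert (S5 : t ^ 4 <= t ^ 3) by (replace (t ^ 4) with (t * t ^ 3) by ring; nra).
    apply Rle_trans with ((a ^ 2 + (2 * a * k + k ^ 2) * t ^ 3) * (1 + t ^ 2) ^ 2).
    { apply Rmult_le_compat_r; [apply pow2_ge_0|auto]. }
    assert (S6 : (2 * a * k + k ^ 2) * t ^ 3 * (1 + t ^ 2) ^ 2 <= (2 * a * k + k ^ 2) * t ^ 3 * 4)
      by (apply Rmult_le_compat_l; auto).
    assert (S7 : a ^ 2 * t ^ 4 <= a ^ 2 * t ^ 3) by (apply Rmult_le_compat_l; [apply pow2_ge_0|auto]).
    unfold K. lra. }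
  apply Rmult_le_reg_r with (t ^ 2); [apply pow_lt; lra|]. lra. }
lra.
Qed.

Lemma holo_real_derivatives (f : C -> C) (R0 x : R) : Rabs x < R0 -> holo R0 f ->
  is_derive (re_trace f) x (Derive (re_trace f) x) /\
  is_derive (im_trace f) x (Derive (im_trace f) x) /\
  is_derive (Derive (re_trace f)) x (Derive_n (re_trace f) 2 x).
Proof.
intros Hx Hf. destruct (local_taylor f R0 x Hx Hf) as (c & r & M & _ & _ & _ & Hre & Him).
split; [|split].
- apply Derive_correct. exact (proj2 (Hre 1%nat)).
- apply Derive_correct. exact (proj2 (Him 1%nat)).
- apply (Derive_correct (Derive (re_trace f))). exact (proj2 (Hre 2%nat)).
Qed.

(** Here a is f^(n)(0) / n!; [C_derive_n_real_axis] at 0 identifies the Taylor coefficients with the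
    given derivatives. *)
Lemma leading_term (f : C -> C) (R0 : R) (n : nat) : 0 < R0 -> holo R0 f ->
  (forall k, (k < n)%nat -> C_derive_n f k (RtoC 0) = RtoC 0) ->
  Im (C_derive_n f n (RtoC 0)) = 0 -> 0 < Re (C_derive_n f n (RtoC 0)) ->
  exists a M d, 0 < a /\ 0 <= M /\ 0 < d /\
    forall x, 0 < x < d -> Cmod (f (RtoC x) - RtoC (a * x ^ n)) <= M * x ^ S n.
Proof.
intros HR0 Hf Hk HIm HRe.
destruct (local_taylor f R0 0) as (c & r & M & Hr & HM & H & Hre & Him); auto.
{ rewrite Rabs_R0; auto. }
assert (Hc : forall k, C_derive_n f k (RtoC 0)
   = (Re (c k) * INR (Factorial.fact k), Im (c k) * INR (Factorial.fact k))).
{ intros k. rewrite (C_derive_n_real_axis f R0 Hf k 0) by (rewrite Rabs_R0; auto).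
  rewrite (proj1 (Hre k)), (proj1 (Him k)). reflexivity. }
assert (Hfact : forall k, 0 < INR (Factorial.fact k)) by apply INR_fact_lt_0.
rewrite Hc in HIm, HRe.
change (Im (c n) * INR (Factorial.fact n) = 0) in HIm.
change (0 < Re (c n) * INR (Factorial.fact n)) in HRe.
assert (Hfn := Hfact n).
assert (HImn : Im (c n) = 0) by (apply Rmult_integral in HIm; destruct HIm; lra).
assert (Ha : 0 < Re (c n)) by (apply Rmult_lt_reg_r with (1 := Hfn); lra).
assert (Hck : forall k, (k < n)%nat -> c k = 0).
{ intros k Hkn. specialize (Hk k Hkn). rewrite Hc in Hk. injection Hk as K1 K2.
  assert (Hfk := Hfact k).
  apply Rmult_integral in K1. apply Rmult_integral in K2.
  apply injective_projections; simpl; [destruct K1|destruct K2]; unfold Re, Im in *; lra. }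
exists (Re (c n)), (M / r ^ S n), r. repeat split; auto.
{ apply Rmult_le_pos; [auto|]. left. apply Rinv_0_lt_compat, pow_lt, Hr. }
intros x Hx. specialize (H (S n) (RtoC x)). rewrite Cmod_R, Rabs_pos_eq in H by lra.
rewrite Cplus_0_l in H.
replace (csum (fun k => c k * RtoC x ^ k)%C (S n)) with (RtoC (Re (c n) * x ^ n)) in H.
- apply Rle_trans with (1 := H (proj2 Hx)). right. unfold Rdiv. ring.
- simpl csum. replace (csum _ n) with (RtoC 0).
  + assert (Ecn : c n = RtoC (Re (c n))) by (apply injective_projections; [reflexivity|exact HImn]).
    rewrite Cpow_RtoC, RtoC_mult, <- Ecn. ring.
  + symmetry. assert (E : forall m, (m <= n)%nat -> csum (fun k => c k * RtoC x ^ k)%C m = 0).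
    { induction m as [|m IHm]; intros Hm; [reflexivity|]. simpl. rewrite IHm, Hck by lia. ring. }
    apply E. lia.
Qed.

(** * Functions whose modulus on each circle is maximal on the positive axis *)

Section maximal_on_positive_axis.

Variables (f : C -> C) (n : nat).
Hypothesis (hf : holo 1 f).
Hypothesis (hn : (1 <= n)%nat).
Hypothesis (hmax : forall z : C, Cmod z < 1 -> Cmod (f z) <= Cmod (f (RtoC (Cmod z)))).
Variables (a M d : R).
Hypotheses (Ha : 0 < a) (HM : 0 <= M) (Hd : 0 < d).
Hypothesis (Hlead : forall x, 0 < x < d -> Cmod (f (RtoC x) - RtoC (a * x ^ n)) <= M * x ^ S n).

Let u := re_trace f.
Let v := im_trace f.

Lemma max_on_circle (x : R) : 0 <= x < 1 -> forall z, Cmod z = x -> Cmod (f z) <= Cmod (f (RtoC x)).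
Proof. intros Hx z Hz. rewrite <- Hz. apply hmax. lra. Qed.

(** A zero at x would spread over the circle |z| = x by maximality, then to all Taylor coefficients,
    then to (0, x), where f(t) ~ a t^n with a > 0. *)
Lemma nonzero_on_axis (x : R) : 0 < x < 1 -> 0 < Cmod (f (RtoC x)).
Proof.
intros Hx. destruct (Rle_lt_or_eq_dec 0 _ (Cmod_ge_0 (f (RtoC x)))) as [H|H]; [exact H|exfalso].
destruct (taylor_expansion f 1 x Hx hf) as [c [B [HB [HT Hz]]]].
assert (Hc : forall k, c k = 0).
{ apply Hz. intros t. apply Cmod_eq_0. apply Rle_antisym; [|apply Cmod_ge_0].
  rewrite H. apply max_on_circle; [lra|]. apply Cmod_circ. lra. }
assert (H0 : forall y, 0 < y < x -> f (RtoC y) = 0).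
{ intros y Hy. apply (zero_coefficients_zero c x B (RtoC y)); auto.
  - rewrite Cmod_R, Rabs_pos_eq; lra.
  - intros N. apply HT. rewrite Cmod_R, Rabs_pos_eq; lra. }
assert (a <= 0); [|lra].
apply (le_0_of_le_linear a M (Rmin x d)); [apply Rmin_pos; lra|].
intros t Ht. generalize (Rmin_l x d) (Rmin_r x d). intros.
specialize (Hlead t ltac:(lra)). rewrite H0 in Hlead by lra.
assert (Ht' : 0 < t ^ n) by (apply pow_lt; lra).
replace (0 - RtoC (a * t ^ n))%C with (- RtoC (a * t ^ n))%C in Hlead by ring.
rewrite Cmod_opp, Cmod_R, Rabs_pos_eq in Hlead by (apply Rmult_le_pos; lra).
apply Rmult_le_reg_r with (t ^ n); [auto|]. simpl in Hlead. lra.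
Qed.

(** Up to sign and the factor |f|^2, the left side is the derivative of arg f along the axis. *)
Lemma argument_stationary (x : R) : 0 < x < 1 -> v x * Derive u x - u x * Derive v x = 0.
Proof.
intros Hx.
destruct (local_taylor f 1 x) as (c & r & B & Hr & HB & H & Hre & Him); auto.
{ rewrite Rabs_pos_eq; lra. }
apply (first_order_condition f x (u x) (v x) (Derive u x) (Derive v x) r (B / r ^ 2)); auto; try lra.
- apply Rmult_le_pos; [auto|]. left. apply Rinv_0_lt_compat, pow_lt, Hr.
- intros h Hh. specialize (H 2%nat h Hh).
  replace ((u x, v x) + (Derive u x, Derive v x) * h)%C with (csum (fun k => c k * h ^ k)%C 2).
  + apply Rle_trans with (1 := H). right. unfold Rdiv. ring.
  + destruct (Hre 0%nat) as [E0 _]. destruct (Hre 1%nat) as [E1 _].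
    destruct (Him 0%nat) as [F0 _]. destruct (Him 1%nat) as [F1 _].
    simpl in E0, F0. change (Derive_n (re_trace f) 1 x) with (Derive u x) in E1.
    change (Derive_n (im_trace f) 1 x) with (Derive v x) in F1. simpl in E1, F1.
    fold u in E0. fold v in F0. rewrite E0, E1, F0, F1. rewrite !Rmult_1_r.
    simpl. destruct (c 0%nat), (c 1%nat), h. apply injective_projections; simpl; ring.
- unfold u, v, re_trace, im_trace. now destruct (f (RtoC x)).
- apply max_on_circle. lra.
Qed.

(* f / |f| is constant on (0,1) and tends to 1 at 0. *)
Lemma trace_real_positive (x : R) : 0 < x < 1 -> v x = 0 /\ 0 < u x.
Proof.
set (N := fun x => sqrt (u x ^ 2 + v x ^ 2)).
assert (HN : forall y, 0 < y < 1 -> 0 < N y) by (intros y Hy; exact (nonzero_on_axis y Hy)).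
assert (Hder : forall y, 0 < y < 1 -> is_derive (fun y => u y / N y) y 0).
{ intros y Hy.
  destruct (holo_real_derivatives f 1 y) as [H1 [H2 _]]; auto; [rewrite Rabs_pos_eq; lra|].
  assert (Hp := HN y Hy). assert (Hs := argument_stationary y Hy).
  assert (HN2 : N y ^ 2 = u y ^ 2 + v y ^ 2).
  { unfold N. rewrite pow2_sqrt; auto. generalize (pow2_ge_0 (u y)) (pow2_ge_0 (v y)); lra. }
  assert (Hpos : 0 < u y ^ 2 + v y ^ 2) by (rewrite <- HN2; now apply pow_lt).
  fold u in H1. fold v in H2.
  set (u' := Derive u y) in *. set (v' := Derive v y) in *.
  replace 0 with ((u' * N y - u y * ((2 * u y * u' + 2 * v y * v') / (2 * N y))) / (N y) ^ 2).
  2: { transitivity (v y * (v y * u' - u y * v') / N y ^ 3).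
       - replace (v y * (v y * u' - u y * v')) with (u' * (u y ^ 2 + v y ^ 2) - u y * (u y * u' + v y * v')) by ring.
         rewrite <- HN2. field. lra.
       - rewrite Hs. field. lra. }
  apply is_derive_div; [exact H1| |lra].
  unfold N. evar_last.
  - apply (is_derive_sqrt (fun y => u y ^ 2 + v y ^ 2)); [|exact Hpos].
    apply (is_derive_plus (fun y => u y ^ 2) (fun y => v y ^ 2)); apply is_derive_pow; eassumption.
  - change (sqrt (u y ^ 2 + v y ^ 2)) with (N y). unfold plus; simpl. field. lra. }
intros Hx.
set (kap := u x / N x).
assert (Hkap : forall y, 0 < y < 1 -> u y = kap * N y).
{ intros y Hy. assert (E := zero_derivative_eq _ 0 1 Hder y x Hy Hx). cbv beta in E. fold kap in E.
  rewrite <- E. field. specialize (HN y Hy). lra. }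
assert (Hk1 : 1 <= kap).
(* Near 0, u is at least a t^n - M t^(n+1) and |f| at most a t^n + M t^(n+1). The sign of [kap] is
   still unknown, and [Rmax 0 kap] is a nonnegative factor by which the bound on |f| can be
   multiplied. *)
{ assert (a * (1 - Rmax 0 kap) <= 0).
  { apply (le_0_of_le_linear _ (M * (1 + Rmax 0 kap)) (Rmin 1 d)); [apply Rmin_pos; lra|].
    intros t Ht. generalize (Rmin_l 1 d) (Rmin_r 1 d). intros.
    specialize (Hlead t ltac:(lra)). assert (Ht' : 0 < t ^ n) by (apply pow_lt; lra).
    assert (L1 := Rle_trans _ _ _ (Re_le_Cmod _) Hlead). apply Rabs_le_between in L1.
    change (Re (f (RtoC t) - RtoC (a * t ^ n))%C) with (u t - a * t ^ n) in L1.
    assert (L2 := Cmod_triangle (f (RtoC t) - RtoC (a * t ^ n)) (RtoC (a * t ^ n))).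
    replace (f (RtoC t) - RtoC (a * t ^ n) + RtoC (a * t ^ n))%C with (f (RtoC t)) in L2 by ring.
    assert (0 <= a * t ^ n) by (apply Rmult_le_pos; lra).
    rewrite (Cmod_R (a * t ^ n)), Rabs_pos_eq in L2 by auto.
    change (Cmod (f (RtoC t))) with (N t) in L2.
    rewrite Hkap in L1 by lra. assert (HNt := HN t ltac:(lra)).
    assert (K1 : kap * N t <= Rmax 0 kap * N t) by (apply Rmult_le_compat_r; [lra|apply Rmax_r]).
    assert (K2 : Rmax 0 kap * N t <= Rmax 0 kap * (a * t ^ n + M * t ^ S n))
      by (apply Rmult_le_compat_l; [apply Rmax_l|lra]).
    apply Rmult_le_reg_r with (t ^ n); [auto|]. simpl in L1, K2. simpl. lra. }
  assert (1 <= Rmax 0 kap) by nra.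
  destruct (Rle_dec 0 kap) as [Hk|Hk]; [rewrite Rmax_right in H0|rewrite Rmax_left in H0]; lra. }
assert (HNx := HN x Hx).
(* Since N = |f|, having u >= N leaves no room for an imaginary part. *)
assert (Hle : N x <= u x) by (rewrite Hkap by auto; nra).
split; [|lra].
assert (HN2 : N x ^ 2 = u x ^ 2 + v x ^ 2).
{ unfold N. rewrite pow2_sqrt; auto. generalize (pow2_ge_0 (u x)) (pow2_ge_0 (v x)); lra. }
assert (N x ^ 2 <= u x ^ 2) by (apply pow_incr; lra).
assert (v x ^ 2 = 0) by (generalize (pow2_ge_0 (v x)); lra).
apply Rmult_integral in H0. destruct H0 as [H0|H0]; [auto|]. lra.
Qed.

Let u1 := Derive u.
Let u2 := Derive_n u 2.

Lemma trace_second_order (x : R) : 0 < x < 1 ->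
  (x * u1 x) ^ 2 <= u x * (x * u1 x + x ^ 2 * u2 x).
Proof.
intros Hx.
destruct (local_taylor f 1 x) as (c & r & B & Hr & HB & H & Hre & Him); auto.
{ rewrite Rabs_pos_eq; lra. }
(* As the imaginary part vanishes near x and not just at x, every Taylor coefficient at x is real,
   which [second_order_condition] requires. *)
assert (Hloc : locally x (fun y => v y = 0)).
{ assert (He : 0 < Rmin x (1 - x)) by (apply Rmin_pos; lra).
  exists (mkposreal _ He). intros y Hy. apply trace_real_positive.
  change (Rabs (y - x) < Rmin x (1 - x)) in Hy. apply Rabs_def2 in Hy.
  generalize (Rmin_l x (1 - x)) (Rmin_r x (1 - x)). lra. }
assert (Hv : forall k, Im (c k) = 0).
{ intros k. destruct (Him k) as [E _]. fold v in E.
  assert (E0 : Derive_n v k x = 0).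
  { transitivity (Derive_n (fun _ : R => 0) k x).
    - exact (Derive_n_ext_loc v (fun _ => 0) k x Hloc).
    - destruct k; [reflexivity|apply Derive_n_const]. }
  rewrite E0 in E.
  symmetry in E. apply Rmult_integral in E. generalize (INR_fact_lt_0 k). destruct E; lra. }
apply (second_order_condition f x (u x) (u1 x) (u2 x) r (B / r ^ 3)); auto; try lra.
- apply Rmult_le_pos; [auto|]. left. apply Rinv_0_lt_compat, pow_lt, Hr.
- apply Rlt_le, trace_real_positive, Hx.
- intros h Hh. specialize (H 3%nat h Hh).
  replace (RtoC (u x) + RtoC (u1 x) * h + RtoC (u2 x / 2) * h ^ 2)%C with (csum (fun k => c k * h ^ k)%C 3).
  + apply Rle_trans with (1 := H). right. unfold Rdiv. ring.
  + destruct (Hre 0%nat) as [E0 _]. destruct (Hre 1%nat) as [E1 _]. destruct (Hre 2%nat) as [E2 _].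
    assert (F0 := Hv 0%nat). assert (F1 := Hv 1%nat). assert (F2 := Hv 2%nat).
    change (Derive_n (re_trace f) 0 x) with (u x) in E0.
    change (Derive_n (re_trace f) 1 x) with (u1 x) in E1.
    change (Derive_n (re_trace f) 2 x) with (u2 x) in E2.
    simpl INR in E0, E1, E2. rewrite E0, E1, E2.
    simpl. destruct (c 0%nat), (c 1%nat), (c 2%nat), h. simpl in F0, F1, F2. subst.
    apply injective_projections; simpl; field.
- assert (E : v x = 0) by now apply trace_real_positive.
  unfold v, im_trace in E. unfold u, re_trace. destruct (f (RtoC x)); simpl in *. now rewrite E.
- apply max_on_circle. lra.
Qed.

(** The slope of log u against log x; it is constantly m for the power x^m. *)
Let h := fun x => x * u1 x / u x.

Lemma trace_derivatives (x : R) : 0 <= x < 1 -> is_derive u x (u1 x) /\ is_derive u1 x (u2 x).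
Proof.
intros Hx. destruct (holo_real_derivatives f 1 x) as [H1 [_ H2]]; auto.
rewrite Rabs_pos_eq; lra.
Qed.

Lemma log_slope_nondecreasing (x y : R) : 0 < x -> x <= y -> y < 1 -> h x <= h y.
Proof.
apply (nonneg_derivative_le h (fun x => ((1 * u1 x + x * u2 x) * u x - x * u1 x * u1 x) / (u x) ^ 2)).
- intros z Hz. destruct (trace_derivatives z) as [H1 H2]; [lra|].
  destruct (trace_real_positive z Hz) as [_ Hu].
  unfold h. apply (is_derive_div (fun z => z * u1 z) u); auto; [|lra].
  apply (is_derive_mult (fun z => z) u1 z 1 (u2 z)); auto.
  + apply (is_derive_id (K := R_AbsRing)).
  + intros; simpl; apply Rmult_comm.
- intros z Hz. destruct (trace_real_positive z Hz) as [_ Hu].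
  assert (H := trace_second_order z Hz).
  apply Rmult_le_pos.
  (* Multiplied by z, the numerator of h' is the gap in [trace_second_order]. *)
  + apply Rmult_le_reg_l with z; lra.
  + left. apply Rinv_0_lt_compat, pow_lt, Hu.
Qed.

(* If h(x) = m < n, then u(y) / y^m is nonincreasing on (0,x], which contradicts u(y) ~ a y^n. *)
Lemma log_slope_ge (x : R) : 0 < x < 1 -> INR n <= h x.
Proof.
intros Hx. apply Rnot_lt_le. intros Hlt. set (m := h x) in *.
(* Logarithms of u(y) / y^m: the derivative of ln u - m ln y is (h - m) / y, which is <= 0 on (0, x]
   by monotonicity of h. *)
assert (HL : forall y, 0 < y <= x -> ln (u x) - m * ln x <= ln (u y) - m * ln y).
{ intros y Hy.
  assert (- (ln (u y) - m * ln y) <= - (ln (u x) - m * ln x)); [|lra].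
  destruct (Rle_lt_or_eq_dec y x) as [Hyx| ->]; [lra| |lra].
  destruct (MVT_cor2 (fun z => - (ln (u z) - m * ln z)) (fun z => - (/ u z * u1 z - m * / z)) y x Hyx)
    as [c [Hc1 Hc2]].
  - intros c Hc. apply is_derive_Reals. destruct (trace_derivatives c) as [H1 _]; [lra|].
    destruct (trace_real_positive c) as [_ Hu]; [lra|].
    apply (is_derive_opp (fun z => ln (u z) - m * ln z)).
    apply (is_derive_minus (fun z => ln (u z)) (fun z => m * ln z)).
    + evar_last.
      * apply (is_derive_comp ln u); [apply is_derive_ln; exact Hu|exact H1].
      * apply Rmult_comm.
    + apply (is_derive_scal ln c m). apply is_derive_ln. lra.
  - destruct (trace_real_positive c) as [_ Hu]; [lra|].
    assert (Hh : h c <= m) by (apply log_slope_nondecreasing; lra).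
    assert (E : / u c * u1 c - m * / c = (h c - m) / c) by (unfold h; field; lra).
    rewrite E in Hc1. assert (0 < / c) by (apply Rinv_0_lt_compat; lra).
    assert (0 <= - ((h c - m) / c) * (x - y)).
    { apply Rmult_le_pos; [|lra]. unfold Rdiv. nra. }
    lra. }
set (K := ln (a + M) - (ln (u x) - m * ln x)).
assert (HK : forall y, 0 < y < Rmin x (Rmin d 1) -> - K <= (INR n - m) * ln y).
{ intros y Hy. generalize (Rmin_l x (Rmin d 1)) (Rmin_r x (Rmin d 1)) (Rmin_l d 1) (Rmin_r d 1). intros.
  specialize (HL y ltac:(lra)).
  assert (L1 := Rle_trans _ _ _ (Re_le_Cmod _) (Hlead y ltac:(lra))). apply Rabs_le_between in L1.
  change (Re (f (RtoC y) - RtoC (a * y ^ n))%C) with (u y - a * y ^ n) in L1.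
  assert (Hyn : 0 < y ^ n) by (apply pow_lt; lra).
  assert (Hu : u y <= (a + M) * y ^ n).
  { assert (M * y ^ S n <= M * y ^ n) by (apply Rmult_le_compat_l; [auto|simpl; nra]). lra. }
  destruct (trace_real_positive y) as [_ Hup]; [lra|].
  assert (HLn : ln (u y) <= ln ((a + M) * y ^ n)).
  { destruct Hu as [Hu|Hu]; [left; now apply ln_increasing|right; now rewrite Hu]. }
  rewrite ln_mult, ln_pow in HLn by lra. unfold K. lra. }
(* Once ln y <= T, the product (n - m) ln y is at most -(|K| + 1), which is below -K and contradicts
   [HK]. *)
set (T := - (Rabs K + 1) / (INR n - m)).
set (y := Rmin (exp T) (Rmin x (Rmin d 1) / 2)).
assert (Hmin : 0 < Rmin x (Rmin d 1)) by (apply Rmin_pos; [lra|apply Rmin_pos; lra]).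
assert (Hy : 0 < y) by (apply Rmin_pos; [apply exp_pos|lra]).
assert (Hy1 : y <= exp T) by apply Rmin_l.
assert (Hy2 : y <= Rmin x (Rmin d 1) / 2) by apply Rmin_r.
specialize (HK y ltac:(lra)).
assert (HT : ln y <= T).
{ rewrite <- (ln_exp T). destruct Hy1 as [Hy1|Hy1]; [left; now apply ln_increasing|right; now rewrite Hy1]. }
assert ((INR n - m) * ln y <= (INR n - m) * T) by (apply Rmult_le_compat_l; lra).
replace ((INR n - m) * T) with (- (Rabs K + 1)) in H by (unfold T; field; lra).
generalize (Rle_abs K). lra.
Qed.

Lemma INR_n_ge_1 : 1 <= INR n.
Proof. change 1 with (INR 1). now apply le_INR. Qed.

Lemma trace_derivative_positive (x : R) : 0 < x < 1 -> 0 < u1 x.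
Proof.
intros Hx. destruct (trace_real_positive x Hx) as [_ Hu].
assert (H := log_slope_ge x Hx). assert (Hn := INR_n_ge_1).
replace (u1 x) with (h x * u x / x) by (unfold h; field; lra).
apply Rdiv_lt_0_compat; [|lra]. apply Rmult_lt_0_compat; lra.
Qed.

(** Substitute x u' = h u in the second-order condition and divide by u. *)
Lemma trace_second_derivative_ge (x : R) : 0 < x < 1 ->
  u x * h x * (h x - 1) <= x ^ 2 * u2 x.
Proof.
intros Hx. destruct (trace_real_positive x Hx) as [_ Hu].
assert (H := trace_second_order x Hx).
apply Rmult_le_reg_l with (u x); [auto|].
assert (E : x * u1 x = h x * u x) by (unfold h; field; lra). rewrite E in H. lra.
Qed.

Lemma trace_second_derivative_nonneg (x : R) : 0 < x < 1 -> 0 <= u2 x.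
Proof.
intros Hx. destruct (trace_real_positive x Hx) as [_ Hu].
assert (H := trace_second_derivative_ge x Hx).
assert (H1 := log_slope_ge x Hx). assert (Hn := INR_n_ge_1).
assert (0 <= u x * h x * (h x - 1)) by (apply Rmult_le_pos; [apply Rmult_le_pos|]; lra).
apply Rmult_le_reg_l with (x ^ 2); [apply pow_lt; lra|]. lra.
Qed.

Lemma linear_of_zero_second_derivative (x : R) : 0 < x < 1 -> u2 x <= 0 ->
  exists alpha, 0 < alpha /\ forall z, Cmod z < 1 -> f z = (RtoC alpha * z)%C.
Proof.
intros Hx H2.
assert (Hn := INR_n_ge_1).
(* From u h (h - 1) <= 0 at x follows h(x) <= 1. Monotonicity carries this to the left, and h >= n
   >= 1 gives equality. *)
assert (Hh : forall y, 0 < y <= x -> h y = 1).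
{ intros y Hy. apply Rle_antisym; [|apply Rle_trans with (INR n); auto; apply log_slope_ge; lra].
  apply Rle_trans with (h x); [apply log_slope_nondecreasing; lra|].
  destruct (trace_real_positive x Hx) as [_ Hu].
  assert (H := trace_second_derivative_ge x Hx). assert (H1 := log_slope_ge x Hx).
  assert (0 < x ^ 2) by (apply pow_lt; lra). assert (0 < u x * h x) by (apply Rmult_lt_0_compat; lra).
  nra. }
assert (Hder : forall y, 0 < y < x -> is_derive (fun y => u y / y) y 0).
{ intros y Hy. destruct (trace_real_positive y) as [_ Hu]; [lra|].
  replace 0 with ((u1 y * y - u y * 1) / y ^ 2).
  - apply (is_derive_div u (fun y => y)); [apply trace_derivatives; lra|apply (is_derive_id (K := R_AbsRing))|lra].
  - specialize (Hh y ltac:(lra)).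
    replace (u1 y * y - u y * 1) with (u y * (h y - 1)) by (unfold h; field; lra).
    rewrite Hh. field. lra. }
(* The quotient u(y) / y is constant on (0, x); x / 2 is just a sample point. *)
set (al := u (x / 2) / (x / 2)).
assert (Hal : 0 < al).
{ apply Rdiv_lt_0_compat; [|lra]. apply trace_real_positive. lra. }
exists al. split; [exact Hal|]. intros z Hz.
assert (E : (f z + (0 + - RtoC al * z))%C = 0).
{ apply (identity_theorem (fun z => f z + (0 + - RtoC al * z))%C 1 x); auto; [|lra|].
  - intros w Hw. destruct (hf w Hw) as [l Hl]. exists (l + - RtoC al)%C.
    intros eps He. destruct (Hl eps He) as [e [He0 H]]. exists e. split; auto.
    intros s Hs. replace (f s + (0 + - al * s) - (f w + (0 + - al * w)) - (l + - al) * (s - w))%C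
      with (f s - f w - l * (s - w))%C by ring. auto.
  - intros y Hy. assert (E := zero_derivative_eq _ 0 x Hder y (x / 2) Hy ltac:(lra)). cbv beta in E.
    fold al in E. destruct (trace_real_positive y) as [Hv _]; [lra|].
    assert (Hu : u y = al * y) by (rewrite <- E; field; lra).
    unfold u, v, re_trace, im_trace in Hu, Hv. destruct (f (RtoC y)) as [p q]; simpl in Hu, Hv.
    rewrite Hu, Hv. apply injective_projections; simpl; ring. }
replace (f z) with ((f z + (0 + - RtoC al * z)) + RtoC al * z)%C by ring. rewrite E. ring.
Qed.

End maximal_on_positive_axis.

(** * Convexity from a monotone derivative, and the conclusion *)

Lemma convex_gap_mean_value (g g' : R -> R) (x y t : R) : x < y -> 0 < t < 1 ->
  (forall z, x <= z <= y -> is_derive g z (g' z)) ->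
  let z := t * x + (1 - t) * y in
  exists c1 c2, x < c1 < z /\ z < c2 < y /\
   t * g x + (1 - t) * g y - g z = t * (1 - t) * (y - x) * (g' c2 - g' c1).
Proof.
intros Hxy Ht Hg z.
assert (E1 : z - x = (1 - t) * (y - x)) by (unfold z; ring).
assert (E2 : y - z = t * (y - x)) by (unfold z; ring).
assert (0 < (1 - t) * (y - x)) by (apply Rmult_lt_0_compat; lra).
assert (0 < t * (y - x)) by (apply Rmult_lt_0_compat; lra).
destruct (MVT_cor2 g g' x z) as [c1 [H1 H1']]; [lra|intros; apply is_derive_Reals, Hg; lra|].
destruct (MVT_cor2 g g' z y) as [c2 [H2 H2']]; [lra|intros; apply is_derive_Reals, Hg; lra|].
exists c1, c2. split; [auto|]. split; [auto|].
rewrite E1 in H1. rewrite E2 in H2.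
(* The convexity gap is an exact combination of the increments on both sides of z, so its sign,
   strict or not, is that of g'(c2) - g'(c1). *)
replace (t * g x + (1 - t) * g y - g z) with ((1 - t) * (g y - g z) - t * (g z - g x)) by ring.
rewrite H1, H2. ring.
Qed.

(** The mean value points are interior, so monotonicity of g' on the open interval gives convexity
    up to the end a. This fits the application, where the sign of g'' is established on (0,1) and
    convexity is wanted on [0,1). *)
Lemma convex_on_of_nondecreasing_derivative (g g' : R -> R) (a b : R) :
  (forall x, a <= x < b -> is_derive g x (g' x)) ->
  (forall x y, a < x -> x <= y -> y < b -> g' x <= g' y) ->
  convex_on (fun x => a <= x < b) g.
Proof.
intros Hg Hg'.
assert (H : forall x y t, a <= x -> x < y -> y < b -> 0 < t < 1 ->
  g (t * x + (1 - t) * y) <= t * g x + (1 - t) * g y).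
{ intros x y t Hx Hxy Hy Ht.
  destruct (convex_gap_mean_value g g' x y t Hxy Ht) as [c1 [c2 [H1 [H2 E]]]].
  { intros; apply Hg; lra. }
  assert (0 <= t * (1 - t) * (y - x) * (g' c2 - g' c1)); [|lra].
  apply Rmult_le_pos.
  - apply Rmult_le_pos; [apply Rmult_le_pos|]; lra.
  - specialize (Hg' c1 c2). lra. }
intros x y t Hx Hy Ht.
destruct (Req_dec t 0) as [->|]; [right; replace (0 * x + (1 - 0) * y) with y by ring; ring|].
destruct (Req_dec t 1) as [->|]; [right; replace (1 * x + (1 - 1) * y) with x by ring; ring|].
destruct (Rtotal_order x y) as [Hxy|[->|Hxy]].
- apply H; lra.
- right. replace (t * y + (1 - t) * y) with y by ring. ring.
- replace (t * x + (1 - t) * y) with ((1 - t) * y + (1 - (1 - t)) * x) by ring.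
  apply Rle_trans with (1 := H y x (1 - t) ltac:(lra) ltac:(lra) ltac:(lra) ltac:(lra)). lra.
Qed.

Lemma strictly_convex_on_of_increasing_derivative (g g' : R -> R) (a b : R) :
  (forall x, a <= x < b -> is_derive g x (g' x)) ->
  (forall x y, a < x -> x < y -> y < b -> g' x < g' y) ->
  strictly_convex_on (fun x => a <= x < b) g.
Proof.
intros Hg Hg'.
assert (H : forall x y t, a <= x -> x < y -> y < b -> 0 < t < 1 ->
  g (t * x + (1 - t) * y) < t * g x + (1 - t) * g y).
{ intros x y t Hx Hxy Hy Ht.
  destruct (convex_gap_mean_value g g' x y t Hxy Ht) as [c1 [c2 [H1 [H2 E]]]].
  { intros; apply Hg; lra. }
  assert (0 < t * (1 - t) * (y - x) * (g' c2 - g' c1)); [|lra].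
  apply Rmult_lt_0_compat.
  - apply Rmult_lt_0_compat; [apply Rmult_lt_0_compat|]; lra.
  - specialize (Hg' c1 c2). lra. }
intros x y t Hx Hy Hxy Ht.
(* The case y < x is the case x < y with t replaced by 1 - t. *)
destruct (Rtotal_order x y) as [Hlt|[Heq|Hlt]]; [apply H; lra|contradiction|].
replace (t * x + (1 - t) * y) with ((1 - t) * y + (1 - (1 - t)) * x) by ring.
apply Rlt_le_trans with (1 := H y x (1 - t) ltac:(lra) ltac:(lra) ltac:(lra) ltac:(lra)). lra.
Qed.

Theorem theorem2p1 (f : C -> C) (n : nat)
  (hf : holomorphic_on unit_disk f)
  (hn : (1 <= n)%nat)
  (hvanish : forall k : nat, (k < n)%nat -> C_derive_n f k (RtoC 0) = RtoC 0)
  (hreal : Im (C_derive_n f n (RtoC 0)) = 0)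
  (hpos : 0 < Re (C_derive_n f n (RtoC 0)))
  (hmax : forall z : C, unit_disk z -> Cmod (f z) <= Cmod (f (RtoC (Cmod z)))) :
  let I := fun x : R => 0 <= x < 1 in
  let g := fun x : R => Re (f (RtoC x)) in
  (forall x : R, I x -> Im (f (RtoC x)) = 0) /\
  (forall x : R, 0 < x < 1 -> 0 < g x) /\
  strictly_increasing_on I g /\
  convex_on I g /\
  (~ (exists alpha : R, 0 < alpha /\
        forall z : C, unit_disk z -> f z = Cmult (RtoC alpha) z) ->
   strictly_convex_on I g).
Proof.
intros I g.
assert (Hf : holo 1 f) by (intros z Hz; apply ex_derive_cderiv, hf, Hz).
destruct (leading_term f 1 n Rlt_0_1 Hf hvanish hreal hpos)
  as (a & M & d & Ha & HM & Hd & Hlead).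
(* The instance k = 0 of the vanishing hypothesis, available because n >= 1; it supplies realness at
   the end 0. *)
assert (Hf0 : f (RtoC 0) = 0) by (apply (hvanish 0%nat); lia).
assert (Hpos : forall x, 0 < x < 1 -> Im (f (RtoC x)) = 0 /\ 0 < g x)
  by (exact (trace_real_positive f n Hf hmax a M d Ha Hd Hlead)).
assert (Hg : forall x, 0 <= x < 1 -> is_derive g x (Derive g x) /\ is_derive (Derive g) x (Derive_n g 2 x))
  by (exact (trace_derivatives f Hf)).
assert (Hg1 : forall x, 0 < x < 1 -> 0 < Derive g x)
  by (exact (trace_derivative_positive f n Hf hn hmax a M d Ha HM Hd Hlead)).
assert (Hg2 : forall x, 0 < x < 1 -> 0 <= Derive_n g 2 x)
  by (exact (trace_second_derivative_nonneg f n Hf hn hmax a M d Ha HM Hd Hlead)).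
split; [|split; [|split; [|split]]].
- intros x [[Hx| <-] Hx1].
  + apply Hpos. lra.
  + now rewrite Hf0.
- intros x Hx. apply Hpos, Hx.
- intros x y Hx Hy Hxy. unfold I in Hx, Hy.
  destruct (MVT_cor2 g (Derive g) x y Hxy) as [c [Hc1 Hc2]].
  { intros c Hc. apply is_derive_Reals, Hg. lra. }
  specialize (Hg1 c ltac:(lra)).
  assert (0 < Derive g c * (y - x)) by (apply Rmult_lt_0_compat; lra). lra.
- apply (convex_on_of_nondecreasing_derivative g (Derive g) 0 1).
  + intros x Hx. apply Hg, Hx.
  + apply nonneg_derivative_le with (Derive_n g 2); [|exact Hg2].
    intros x Hx. apply Hg. lra.
- intros Hnot.
  apply (strictly_convex_on_of_increasing_derivative g (Derive g) 0 1).
  + intros x Hx. apply Hg, Hx.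
  + intros x y Hx Hxy Hy.
    destruct (MVT_cor2 (Derive g) (Derive_n g 2) x y Hxy) as [c [Hc1 Hc2]].
    { intros c Hc. apply is_derive_Reals, Hg. lra. }
    assert (0 < Derive_n g 2 c).
    (* A single point of (0,1) with g'' <= 0 would already make f linear on the whole disk. *)
    { apply Rnot_le_lt. intros Hc. apply Hnot.
      apply (linear_of_zero_second_derivative f n Hf hn hmax a M d Ha HM Hd Hlead c);
        [lra|exact Hc]. }
    assert (0 < Derive_n g 2 c * (y - x)) by (apply Rmult_lt_0_compat; lra). lra.
Qed.
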